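(* Let $n\in\mathbb{N}$ and let $G:\mathbb{R}\to\mathbb{R}$ be an even function satisfying the regularity assumptions in the context. Suppose $(m^{(N)})_{N\in\mathbb{N}}\subseteq\mathcal{X}$ and $m\in\mathcal{X}$ satisfy $m^{(N)}(t)\stackrel{w^*}{\to}m(t)$ as $N\to\infty$ for all $t\in\mathbb{R}^+$. Define $u(t)=G*(m(t))$ and $u^{(N)}(t)=G*(m^{(N)}(t))$ for $t\in\mathbb{R}^+$, $N\in\mathbb{N}$, and identify these with functions on $\Omega=\mathbb{R}^+\times\mathbb{R}$ by $u(t,x)=u(t)(x)$ and $u^{(N)}(t,x)=u^{(N)}(t)(x)$. Let $\psi\in C_c^\infty(\Omega)$, $0\leqslant k\leqslant n$ and $\ell\in\mathbb{N}$. Then $$\lim_{N\to\infty}\int_{-\infty}^{\infty}\psi(0,x)\,d(m^{(N)}(0))(x)=\int_{-\infty}^{\infty}\psi(0,x)\,d(m(0))(x)$$ and $$\lim_{N\to\infty}\int_0^\infty\int_{-\infty}^\infty\left((\partial_x^k u^{(N)}(t,x))^\ell-(\partial_x^k u(t,x))^\ell\right)\psi(t,x)\,dx\,dt=0.$$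
   Context: Assumptions on $G$: $G:\mathbb{R}\to\mathbb{R}$ is even, the classical derivative $G^{(k)}$ of order $k$ is defined everywhere, absolutely continuous and integrable on $\mathbb{R}$ for $0\leqslant k<n$, and there exists $F\in BV(\mathbb{R})$ (an integrable function of bounded variation) that agrees with $G^{(n)}$ almost everywhere on $\mathbb{R}$. $\mathbb{R}^+=[0,\infty)$. $C_c^\infty(\Omega)$ is the space of compactly supported functions on $\Omega$ having derivatives of all orders (they need not vanish at $t=0$). $C_0(\mathbb{R})$ is the space of continuous real functions on $\mathbb{R}$ vanishing at infinity, with the supremum norm $\|\cdot\|_\infty$; $\mathcal{M}(\mathbb{R})$ is the space of finite signed Radon measures on $\mathbb{R}$, identified with the dual of $C_0(\mathbb{R})$, and $w^*$ is the weak$^*$-topology: $\mu_N\stackrel{w^*}{\to}\mu$ means $\int f\,d\mu_N\to\int f\,d\mu$ for all $f\in C_0(\mathbb{R})$. $B_{\mathcal{M}^+(\mathbb{R})}$ is the set of positive measures of total variation at most $1$. $(G*\mu)(x)=\int_{\mathbb{R}} G(x-y)\,d\mu(y)$. For $t\in\mathbb{R}^+$, $G*(m(t))$ and $G*(m^{(N)}(t))$ belong to $H^n(\mathbb{R})$; $\partial_x^k u(t,\cdot)$ denotes the $k$-th derivative in $x$, which equals $G^{(k)}*(m(t))$ almost everywhere (with $G^{(n)}$ interpreted as its $BV(\mathbb{R})$ representative), and similarly for $u^{(N)}$. $\|\mu\|_{BL}=\sup\{\int f\,d\mu: f\in C_0(\mathbb{R}),\ \|f\|_\infty+\mathrm{Lip}(f)\leqslant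 1\}$, where $\mathrm{Lip}(f)$ is the Lipschitz constant, and $d(\mu,\nu)=\|\mu-\nu\|_{BL}$. $\mathcal{X}$ is the set of all $d$-continuous maps $m:\mathbb{R}^+\to B_{\mathcal{M}^+(\mathbb{R})}$. *)

(* Defs.v *)
From HB Require Import structures.
From mathcomp Require Import all_boot all_order all_algebra.
From mathcomp Require Import all_classical all_reals all_analysis.
Set Implicit Arguments.
Unset Strict Implicit.
Unset Printing Implicit Defensive.
Import Order.TTheory GRing.Theory Num.Theory.
Import numFieldNormedType.Exports.

Local Open Scope classical_set_scope.
Local Open Scope ring_scope.

Definition Rplus (R : realType) : set R := [set t | 0 <= t].

Definition Omega (R : realType) : set (R * R) := [set p | 0 <= p.1].

Definition abs_continuous (R : realType) (f : R -> R) : Prop :=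
  forall e : R, 0 < e -> exists2 d : R, 0 < d &
    forall (N : nat) (a b : 'I_N -> R),
      (forall i, a i <= b i) ->
      (forall i j, i != j -> b i <= a j \/ b j <= a i) ->
      \sum_(i < N) (b i - a i) < d ->
      \sum_(i < N) `|f (b i) - f (a i)| < e.

Definition BVR (R : realType) (F : R -> R) : Prop :=
  (@lebesgue_measure R).-integrable setT (EFin \o F) /\
  (ereal_sup [set total_variation ab.1 ab.2 F
             | ab in [set ab : R * R | (ab.1 <= ab.2)%R]] < +oo)%E.

(* The first clause makes [derive1n k G] a genuine classical derivative at every
   point for k < n (for k = 0 there is nothing to ask); at order n, [derive1n n G]
   only has to agree with [F] almost everywhere. *)
Definition kernel_regular (R : realType) (n : nat) (G : R -> R) : Prop :=
  [/\ forall j, (j.+1 < n)%N -> forall x : R, derivable (derive1n j G) x 1,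
      forall k, (k < n)%N -> abs_continuous (derive1n k G),
      forall k, (k < n)%N ->
        (@lebesgue_measure R).-integrable setT (EFin \o derive1n k G) &
      exists2 F : R -> R, BVR F &
        {ae @lebesgue_measure R, forall x, derive1n n G x = F x}].

Definition C0 (R : realType) (f : R -> R) : Prop :=
  [/\ continuous f, f x @[x --> +oo] --> (0 : R)
    & f x @[x --> -oo] --> (0 : R)].

Definition sup_norm (R : realType) (f : R -> R) : \bar R :=
  ereal_sup [set `|f x|%:E | x in setT].

Definition Lip (R : realType) (f : R -> R) : \bar R :=
  ereal_sup [set (`|f p.1 - f p.2| / `|p.1 - p.2|)%:E
            | p in [set p : R * R | p.1 != p.2]].

(* A finite signed measure is represented by the functional f |-> \int f dmu
   on C_0(R) that it induces; [BL_dist mu nu] is the norm of mu - nu. *)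
Definition BL_norm (R : realType) (L : (R -> R) -> R) : \bar R :=
  ereal_sup [set (L f)%:E
            | f in [set f | C0 f /\ (sup_norm f + Lip f <= 1)%E]].

(* [posball R] is the set of positive Borel measures on R of total variation
   (that is, total mass) at most 1; on R, finite Borel measures are Radon. *)
Definition posball (R : realType) : Type :=
  subprobability (measurableTypeR R) R.

Definition BL_dist (R : realType) (mu nu : posball R) : \bar R :=
  BL_norm (fun f => \int[mu]_x f x - \int[nu]_x f x).

(* Values of [m] at negative times are irrelevant. *)
Definition curveX (R : realType) (m : R -> posball R) : Prop :=
  forall t : R, 0 <= t ->
    BL_dist (m s) (m t) @[s --> within (@Rplus R) (nbhs t)] --> 0%E.

Definition weak_star_cvg (R : realType) (muN : nat -> posball R)
    (mu : posball R) : Prop :=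
  forall f : R -> R, C0 f ->
    \int[muN N]_x f x @[N --> \oo] --> \int[mu]_x f x.

Definition convolution (R : realType) (G : R -> R) (mu : posball R) : R -> R :=
  fun x => \int[mu]_y G (x - y).

(* The time derivative is one-sided at t = 0. *)
Definition has_dt (R : realType) (psi dpsi : R * R -> R) : Prop :=
  forall t x : R, 0 <= t ->
    (psi (s, x) - psi (t, x)) / (s - t) @[s --> within (@Rplus R) t^']
      --> dpsi (t, x).

Definition has_dx (R : realType) (psi dpsi : R * R -> R) : Prop :=
  forall t x : R, 0 <= t ->
    is_derive x (1 : R) (fun y => psi (t, y)) (dpsi (t, x)).

Fixpoint Ck_Omega (R : realType) (k : nat) (psi : R * R -> R) : Prop :=
  {within @Omega R, continuous psi} /\
  match k with
  | 0%N => True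
  | j.+1 => exists psit psix : R * R -> R,
      [/\ has_dt psi psit, has_dx psi psix, Ck_Omega j psit & Ck_Omega j psix]
  end.

(* Only the restriction of [psi] to [Omega] matters. As [Omega] is closed, the
   closure below is the support relative to [Omega]; it may meet t = 0. *)
Definition Cc_infty_Omega (R : realType) (psi : R * R -> R) : Prop :=
  (forall k, Ck_Omega k psi) /\
  compact (closure (@Omega R `&` [set p | psi p != 0])).

(* Main.v *)
(* Tested against [psi], the difference of the powers is controlled, on a compact
   set, by the L1 distance between the two convolutions, because all of them are
   bounded by a common constant. For k <= n the k-th derivative of [G * mu] is
   almost everywhere [H * mu] for a bounded integrable [H] not depending on [mu]:
   for k < n this is [G^(k)], for k = n it is the BV representative. As
   convolution with a measure of mass at most 1 does not increase the L1 norm,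
   [H] may be replaced by a compactly supported continuous kernel, for which
   weak* convergence is pointwise convergence of the convolutions. Dominated
   convergence is then applied in x and in t.

   The step from G^(n-1) to F needs the fundamental theorem of calculus for
   absolutely continuous functions: the variation function of such a function
   induces a Stieltjes measure dominated by Lebesgue measure, and its
   Radon-Nikodym density is the derivative almost everywhere.

   No joint measurability in (t, x) is used: the library integral of a
   nonnegative function is a supremum over simple functions below it, so it is
   monotone, and satisfies dominated convergence to 0, without measurability. *)

Require Import Defs.
From HB Require Import structures.
From mathcomp Require Import all_boot all_order all_algebra.
From mathcomp Require Import all_classical all_reals all_analysis.
From mathcomp Require Import measurable_realfun.
From mathcomp Require Import ring lra.
Import Order.TTheory GRing.Theory Num.Theory.
Import numFieldNormedType.Exports.
Local Open Scope classical_set_scope.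
Local Open Scope ring_scope.
Set Implicit Arguments.
Unset Strict Implicit.
Unset Printing Implicit Defensive.

(** * Integrals of possibly non-measurable functions *)

Section LowerIntegral.
Context d (T : measurableType d) (R : realType) (mu : {measure set T -> \bar R}).
Implicit Types D : set T.
Import HBNNSimple.

Lemma ge0_le_integral_lower D (f g : T -> \bar R) :
  (forall x, D x -> 0 <= f x)%E -> (forall x, D x -> f x <= g x)%E ->
  (\int[mu]_(x in D) f x <= \int[mu]_(x in D) g x)%E.
Proof.
move=> f0 fg; rewrite !ge0_integralE//; last first.
  by move=> x Dx; exact: le_trans (f0 x Dx) (fg x Dx).
apply: ge_ereal_sup => _ [h hf <-]; apply: ereal_sup_ubound; exists h => // x.
apply: (le_trans (hf x)); rewrite !patchE; case: ifPn => //.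
by rewrite inE => /fg.
Qed.

(** Making [g] infinite on the exceptional null set turns the almost everywhere bound into a
    pointwise one. Since [g] is measurable, this change does not affect its integral. *)
Lemma ge0_ae_le_integral_lower D (f g : T -> \bar R) : measurable D ->
  (forall x, D x -> 0 <= f x)%E -> (forall x, D x -> 0 <= g x)%E ->
  measurable_fun D g -> {ae mu, forall x, D x -> (f x <= g x)%E} ->
  (\int[mu]_(x in D) f x <= \int[mu]_(x in D) g x)%E.
Proof.
move=> mD f0 g0 mg [N [mN N0 subN]].
pose g' x := if x \in N then +oo%E else g x.
apply: (@le_trans _ _ (\int[mu]_(x in D) g' x)%E).
  apply: ge0_le_integral_lower => // x Dx; rewrite /g'.
  have [_|/negP xN] := boolP (x \in N); first exact: leey.
  apply: contrapT => fgx; apply: xN; rewrite inE; apply: subN => /= h.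
  exact/fgx/h.
rewrite le_eqVlt; apply/orP; left; apply/eqP.
apply: ge0_ae_eq_integral => //.
- apply: measurable_fun_if => //.
    by apply: (measurable_fun_bool true); rewrite preimage_mem_true; exact: measurableI.
  apply: measurable_funS mg => //; exact: subIsetl.
- by move=> x Dx; rewrite /g'; case: ifPn => // _; exact: g0.
- exists N; split => // x /= h; apply: contrapT => xN; apply: h => Dx.
  by rewrite /g' memNset.
Qed.

(** The positive and negative parts both lie below [|f|], so their integrals lie in [[0, c]] by
    monotonicity alone, and the difference of two such numbers lies in [[-c, c]]. *)
Lemma normr_Rintegral_le D (f : T -> R) (c : R) :
  (\int[mu]_(x in D) `|f x|%:E <= c%:E)%E -> `|\int[mu]_(x in D) f x| <= c.
Proof.
move=> fc; rewrite /Rintegral integralE.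
set p := integral _ _ _; set q := integral _ _ _.
have p0 : (0 <= p)%E by apply: integral_ge0.
have q0 : (0 <= q)%E by apply: integral_ge0.
have pc : (p <= c%:E)%E.
  apply: le_trans fc; apply: ge0_le_integral_lower => // x _ /=.
  by rewrite funeposE /= ge_max lee_fin ler_norm lee_fin normr_ge0.
have qc : (q <= c%:E)%E.
  apply: le_trans fc; apply: ge0_le_integral_lower => // x _ /=.
  rewrite funenegE /= ge_max !lee_fin normr_ge0 andbT.
  by rewrite -normrN ler_norm.
have pf : p \is a fin_num by rewrite ge0_fin_numE// (le_lt_trans pc)// ltry.
have qf : q \is a fin_num by rewrite ge0_fin_numE// (le_lt_trans qc)// ltry.
move: p0 q0 pc qc; rewrite -(fineK pf) -(fineK qf) -EFinB /= !lee_fin.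
move=> p0 q0 pc qc; rewrite ler_norml; apply/andP; split.
  by rewrite lerBrDr (le_trans _ p0)// addrC subr_le0.
by rewrite lerBlDr (le_trans pc)// lerDl.
Qed.

Lemma le_normr_Rintegral_lower D (f : T -> R) :
  (`|\int[mu]_(x in D) f x|%:E <= \int[mu]_(x in D) `|f x|%:E)%E.
Proof.
set I := (\int[mu]_(x in D) _)%E.
have I0 : (0 <= I)%E by apply: integral_ge0 => x _; rewrite lee_fin.
case E : I I0 => [r|//|//] _; last exact: leey.
by rewrite lee_fin; apply: normr_Rintegral_le; rewrite -/I E.
Qed.

(* The integral of a non-measurable nonnegative function is a supremum of
   integrals of simple functions below it; near-optimal ones inherit the
   dominated pointwise convergence to 0. *)
Lemma dominated_cvg0_lower D (f_ : nat -> T -> R) (g : T -> R) : measurable D ->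
  (forall n x, D x -> 0 <= f_ n x) -> (forall n x, D x -> f_ n x <= g x) ->
  mu.-integrable D (EFin \o g) ->
  (forall x, D x -> f_ n x @[n --> \oo] --> (0 : R)) ->
  ((\int[mu]_(x in D) (f_ n x)%:E) @[n --> \oo] --> 0)%E.
Proof.
move=> mD f0 fg ig f_0.
have Ifin n : (\int[mu]_(x in D) (f_ n x)%:E)%E \is a fin_num.
  rewrite ge0_fin_numE; last by apply: integral_ge0 => x Dx; rewrite lee_fin f0.
  apply: le_lt_trans (integrableP _ _ _ ig).2.
  apply: ge0_le_integral_lower => x Dx; first by rewrite lee_fin f0.
  by rewrite /= lee_fin (le_trans (fg n x Dx))// ler_norm.
have /choice[h hP] : forall n, exists h : {nnsfun T >-> R},
    (forall x, (h x)%:E <= ((EFin \o f_ n) \_ D) x)%E /\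
    (\int[mu]_(x in D) (f_ n x)%:E - n.+1%:R^-1%:E < sintegral mu h)%E.
  move=> n; have := Ifin n.
  rewrite ge0_integralE; last by move=> x Dx; rewrite lee_fin f0.
  move=> If; have n0 : 0 < n.+1%:R^-1 :> R by rewrite invr_gt0.
  have [_ [h hf <-] hI] := ub_ereal_sup_adherent n0 If.
  by exists h.
(* Being nonnegative and below the extension of [f_ n] by zero, [h n] vanishes outside [D]. *)
have hE n : (\int[mu]_(x in D) (h n x)%:E = sintegral mu (h n))%E.
  rewrite integral_nnsfun//; apply: eq_sintegral => x.
  rewrite patchE; case: ifPn => // xD.
  have := (hP n).1 x; rewrite patchE (negbTE xD) lee_fin => hx.
  by apply/eqP; rewrite eq_le hx fun_ge0.
have hle n x : D x -> h n x <= f_ n x.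
  by move=> Dx; have := (hP n).1 x; rewrite patchE mem_set//= lee_fin.
have hc : ((\int[mu]_(x in D) (h n x)%:E) @[n --> \oo] --> 0)%E.
  have := @dominated_convergence _ _ _ mu D mD (fun n x => (h n x)%:E)
    (cst 0%E) (EFin \o g).
  rewrite integral0; case => //.
  - by move=> n; apply/measurable_EFinP; exact: measurable_funTS.
  - apply: aeW => x Dx; apply: cvg_EFin; first exact: nearW.
    apply: (@squeeze_cvgr _ _ _ _ (cst 0) (f_ ^~ x)); last 2 first.
    + exact: cvg_cst.
    + exact: f_0.
    by apply: nearW => n; rewrite hle// fun_ge0.
  - apply: aeW => x n Dx; rewrite /= lee_fin ger0_norm ?fun_ge0//.
    by rewrite (le_trans (hle n x Dx))// fg.
apply: (@squeeze_cvge _ _ _ _ (cst 0%E) _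
  (fun n => \int[mu]_(x in D) (h n x)%:E + n.+1%:R^-1%:E)%E).
- apply: nearW => n; apply/andP; split.
    by apply: integral_ge0 => x Dx; rewrite lee_fin f0.
  by have := (hP n).2; rewrite hE lteBlDr// => /ltW.
- exact: cvg_cst.
- rewrite -[X in _ --> X]adde0; apply: cvgeD => //.
  apply: cvg_EFin; first exact: nearW.
  exact: cvg_harmonic.
Qed.

(** For the positive and negative parts, one inequality is the almost everywhere comparison. For the
    other, the null set is first removed from the integral of the measurable side, and plain
    monotonicity then suffices. *)
Lemma ae_eq_Rintegral_lower (f g : T -> R) : measurable_fun setT g ->
  {ae mu, forall x, f x = g x} -> \int[mu]_x f x = \int[mu]_x g x.
Proof.
move=> mg [N [mN N0 subN]].
have key (p q : T -> \bar R) : (forall x, 0 <= p x)%E -> (forall x, 0 <= q x)%E ->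
    measurable_fun setT q -> (forall x, ~ N x -> p x = q x) ->
    (\int[mu]_x p x = \int[mu]_x q x)%E.
  move=> p0 q0 mq pq; apply/eqP; rewrite eq_le; apply/andP; split.
    apply: ge0_ae_le_integral_lower => //; exists N; split => // x /= npq.
    by apply: contrapT => /pq e; apply: npq => _; rewrite e.
  rewrite (@ge0_negligible_integral _ _ _ mu setT N)//.
  rewrite integral_mkcondr; apply: ge0_le_integral_lower => // x _.
    by rewrite patchE; case: ifPn.
  by rewrite patchE; case: ifPn => //; rewrite inE => /pq ->.
have fgN x : ~ N x -> f x = g x.
  by move=> Nx; apply: contrapT => fgx; apply: Nx; exact: subN.
rewrite /Rintegral integralE [in RHS]integralE; congr (fine (_ - _)).
- apply: key => //; first by apply: measurable_funepos; exact/measurable_EFinP.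
  by move=> x /fgN; rewrite !funeposE /= => ->.
- apply: key => //; first by apply: measurable_funeneg; exact/measurable_EFinP.
  by move=> x /fgN; rewrite !funenegE /= => ->.
Qed.

End LowerIntegral.

(** * Variation of absolutely continuous functions *)

Section AbsolutelyContinuousVariation.
Context (R : realType).
Implicit Types (f : R -> R) (s : seq (R * R)).

Definition separated (p q : R * R) := (p.2 <= q.1) || (q.2 <= p.1).

(** The families tested in [abs_continuous], as lists, so that members can be replaced by their
    subdivisions. *)
Definition short_family (d : R) s :=
  [/\ all (fun p => p.1 <= p.2) s, pairwise separated s
    & \sum_(p <- s) (p.2 - p.1) < d].

Lemma separated_sym p q : separated p q = separated q p.
Proof. by rewrite /separated orbC. Qed.

Lemma abs_continuous_family f : abs_continuous f -> forall e, 0 < e ->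
  exists2 d : R, 0 < d & forall s, short_family d s ->
    \sum_(p <- s) `|f p.2 - f p.1| < e.
Proof.
move=> acf e /acf[d d0 H]; exists d => // s [/allP sle /(pairwiseP (0, 0)) ssep].
rewrite !(big_nth (0, 0)) !big_mkord => sd.
apply: (H _ (fun i => (nth (0, 0) s i).1) (fun i => (nth (0, 0) s i).2)) => //.
  by move=> i; apply: sle; rewrite mem_nth.
move=> i j ij.
have /orP[lij|lij] : (i < j)%N || (j < i)%N by rewrite -neq_ltn.
  have /orP[|] := ssep i j (ltn_ord i) (ltn_ord j) lij; tauto.
have /orP[|] := ssep j i (ltn_ord j) (ltn_ord i) lij; tauto.
Qed.

Lemma short_family_cons d p s : short_family d (p :: s) -> short_family d s.
Proof.
move=> [/= /andP[pp ss] /andP[_ sep]]; rewrite big_cons => h; split => //.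
by apply: le_lt_trans h; rewrite lerDr subr_ge0.
Qed.

Lemma itv_partition_family a b (t : seq R) : itv_partition a b t ->
  let s := zip (a :: t) t in
  [/\ forall p, p \in s -> [/\ a <= p.1, p.1 <= p.2 & p.2 <= b],
      pairwise separated s & \sum_(p <- s) (p.2 - p.1) = b - a].
Proof.
elim: t a => [a /itv_partition_nil -> /=|x t IH a abt].
  by rewrite big_nil subrr.
have xbt := itv_partition_cons abt; have [IH1 IH2 IH3] := IH _ xbt.
have ax : a < x by case: abt => /= /andP[].
have xb := itv_partition_le xbt.
split => [p||] /=.
- rewrite inE => /predU1P[->/=|/IH1[xp pp pb]]; first by rewrite lexx (ltW ax).
  by rewrite (le_trans (ltW ax) xp).
- rewrite IH2 andbT; apply/allP => p /IH1[xp _ _].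
  by rewrite /separated /= xp.
- by rewrite big_cons /= IH3; ring.
Qed.

Lemma big_zip_swap (F : R -> R -> R) (t u : seq R) :
  \sum_(x <- zip t u) F x.1 x.2 = \sum_(x <- zip u t) F x.2 x.1.
Proof.
by elim: t u => [|x t IH] [|y u] /=; rewrite ?big_nil // !big_cons IH.
Qed.

(* Intervals are refined one at a time: [s1] collects the pieces of intervals
   already subdivided, [s2] the intervals still carrying their variation. *)
Lemma abs_continuous_TV f : abs_continuous f -> forall e, 0 < e ->
  exists2 d : R, 0 < d & forall s, short_family d s ->
    (\sum_(p <- s) total_variation p.1 p.2 f <= e%:E)%E.
Proof.
move=> acf e /(abs_continuous_family acf)[d d0 H]; exists d => // s.
suff aux s2 s1 : short_family d (s2 ++ s1) ->
    ((\sum_(p <- s1) `|f p.2 - f p.1|)%:E +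
     \sum_(p <- s2) total_variation p.1 p.2 f <= e%:E)%E.
  by move=> sf; have := aux s [::]; rewrite cats0 big_nil add0e; exact.
elim: s2 s1 => [s1 /H /ltW|p s2 IH s1 sf]; first by rewrite big_nil adde0 lee_fin.
have [/= /andP[_ sle] /andP[psep ssep] sd] := sf.
have IH1 := IH _ (short_family_cons sf).
set S1 := (X in (X%:E + _)%E) in IH1 *.
rewrite big_cons; set S2 := (X in (_ + X <= _)%E) in IH1 *.
have S20 : (0 <= S2)%E.
  rewrite /S2 big_seq; apply: sume_ge0 => q qs2; apply: total_variation_ge0.
  by move/allP: sle; apply; rewrite mem_cat qs2.
have S2f : S2 \is a fin_num.
  rewrite ge0_fin_numE//; apply: le_lt_trans (ltry e); apply: le_trans IH1.
  by rewrite leeDr// lee_fin sumr_ge0.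
rewrite (addeCA _ _ S2) -(fineK S2f) -EFinD -leeBrDr//.
(* The variation over [p] is a supremum over partitions, so one partition [t] is fixed; its pieces
   then move to the subdivided part of the family. *)
apply: ge_ereal_sup => _ [_ [t tp <-] <-]; rewrite leeBrDr//.
rewrite (variation_zip _ tp) (big_zip_swap (fun x y => `|f x - f y|)) -EFinD lee_fin.
have [t1 t2 t3] := itv_partition_family tp.
pose pcs := zip (p.1 :: t) t.
(* Replacing [p] by its pieces keeps the total length, and the pieces inherit from [p] the
   separation from all other intervals. *)
have sf' : short_family d (s2 ++ (pcs ++ s1)).
  move: sle ssep; rewrite all_cat pairwise_cat => /andP[sle2 sle1].
  move=> /and3P[ss21 ss2 ss1]; split.
  - by rewrite !all_cat sle2 sle1 andbT; apply/allP => q /t1[].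
  - have psepE q r : q \in pcs -> separated p r -> separated q r.
      move=> /t1[pq _ qp] /orP[h|h]; apply/orP.
        by left; exact: le_trans h.
      by right; exact: le_trans pq.
    rewrite !pairwise_cat allrel_catr ss21 ss2 ss1 t2 !andbT /=; apply/andP; split.
      apply/allrelP => r q rs qp; rewrite separated_sym; apply: psepE => //.
      by move/allP : psep; apply; rewrite mem_cat rs.
    apply/allrelP => q r qp rs; apply: psepE => //.
    by move/allP : psep; apply; rewrite mem_cat rs orbT.
  - move: sd; rewrite big_cons !big_cat /= t3; lra.
have := IH _ sf'; rewrite -/S2 -(fineK S2f) -EFinD lee_fin big_cat /= => IH2.
lra.
Qed.


(** With [d] chosen for the bound 1, an interval of length at most [d / 2] has variation at most 1,
    and finitely many of these cover [[a, b]]. Halving [d] provides the strict inequality in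
    [short_family]. *)
Lemma abs_continuous_TV_lty f a b : abs_continuous f -> a <= b ->
  (total_variation a b f < +oo)%E.
Proof.
move=> acf ab; have [d d0 H] := abs_continuous_TV acf ltr01.
have d20 : 0 < d / 2 by rewrite divr_gt0.
have short x y : x <= y -> y - x <= d / 2 -> (total_variation x y f < +oo)%E.
  move=> xy yx; have := H [:: (x, y)]; rewrite !big_seq1 /= => h.
  apply: le_lt_trans (ltry 1); apply: h; split; rewrite /= ?xy// big_seq1 /=; lra.
have [K bK] : exists K, b - a <= K%:R * (d / 2).
  exists (Num.trunc ((b - a) / (d / 2))).+1.
  by rewrite -ler_pdivrMr//; exact/ltW/truncnS_gt.
elim: K a ab bK => [a ab|K IH a ab bK].
  rewrite mul0r subr_le0 => ba.
  have -> : b = a by apply/eqP; rewrite eq_le ba.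
  by rewrite total_variationxx.
have [bad|dba] := leP (b - a) (d / 2); first exact: short.
rewrite (@total_variationD _ _ _ (a + d / 2)); [|lra|lra].
apply: lte_add_pinfty; first by apply: short; lra.
by apply: IH; [lra|move: bK; rewrite -natr1 mulrDl mul1r; lra].
Qed.

Definition abs_nondecreasing (W : R -> R) :=
  {homo W : x y / x <= y} /\
  forall e, 0 < e -> exists2 d : R, 0 < d & forall s, short_family d s ->
    \sum_(p <- s) (W p.2 - W p.1) <= e.

(** Jordan decomposition: [V] is the variation from [a] and [W] is [V - f]. The clamp [c] onto
    [[a, b]] makes both monotone on the whole line and never lengthens an interval, so
    [abs_continuous_TV] controls the increments of [V]. *)
Lemma abs_continuous_nondecreasing f a b : abs_continuous f -> a <= b ->
  exists V W : R -> R, [/\ abs_nondecreasing V, abs_nondecreasing W &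
    forall x, a <= x <= b -> f x = V x - W x].
Proof.
move=> acf ab; pose c x := Num.max a (Num.min x b).
have ca x : a <= c x by rewrite le_max lexx.
have cb x : c x <= b by rewrite ge_max ab ge_min lexx orbT.
have cle x y : x <= y -> c x <= c y.
  move=> xy; rewrite /c ge_max le_max lexx /= le_max; apply/orP; right.
  by rewrite le_min !ge_min xy lexx orbT.
have cid x : a <= x <= b -> c x = x.
  by move=> /andP[ax xb]; rewrite /c min_l// max_r.
have cshort x y : x <= y -> c y - c x <= y - x.
  by move=> xy; rewrite /c; case: (leP y b) => yb; case: (leP x b) => xb;
    case: (leP a b) => ba; case: (leP a y) => ay; case: (leP a x) => ax; lra.
pose TV x y := total_variation x y f.
have TVf x y : x <= y -> TV x y \is a fin_num.
  move=> xy; rewrite ge0_fin_numE; first exact: abs_continuous_TV_lty.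
  exact: total_variation_ge0.
pose V x := fine (TV a (c x)).
have VD x y : x <= y -> V y - V x = fine (TV (c x) (c y)).
  move=> xy; rewrite /V /TV (@total_variationD _ a (c y) (c x))// ?cle//.
  by rewrite fineD ?TVf ?cle// addrC addKr.
have fV x y : x <= y -> `|f (c y) - f (c x)| <= V y - V x.
  move=> xy; rewrite VD// -lee_fin fineK ?TVf ?cle//.
  exact/total_variation_ge/cle.
have Vac e : 0 < e -> exists2 d : R, 0 < d & forall s, short_family d s ->
    \sum_(p <- s) (V p.2 - V p.1) <= e.
  move=> /(abs_continuous_TV acf)[d d0 H]; exists d => // s [sle ssep sd].
  have := H [seq (c p.1, c p.2) | p <- s]; rewrite !big_map /= => h.
  rewrite -lee_fin -sumEFin; apply: le_trans (h _); last split.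
  - rewrite big_seq [leRHS]big_seq; apply: lee_sum => p ps.
    have pp : p.1 <= p.2 by move/allP : sle; apply.
    by rewrite VD// fineK// TVf// cle.
  - by apply/allP => _ /mapP[p ps ->] /=; apply: cle; move/allP : sle; apply.
  - rewrite pairwise_map; apply: sub_pairwise ssep => p q /orP[h'|h'] /=; apply/orP.
      by left; exact: cle.
    by right; exact: cle.
  - rewrite big_map; apply: le_lt_trans sd; rewrite big_seq [leRHS]big_seq.
    by apply: ler_sum => p ps; apply: cshort; move/allP : sle; apply.
have V0 x y : x <= y -> 0 <= V y - V x by move=> /fV; exact: le_trans.
exists V, (fun x => V x - f (c x)); split.
- by split=> // x y /V0; rewrite subr_ge0.
- split=> [x y /fV|e e0].
    by rewrite ler_norml => /andP[_]; lra.
  (* An increment of [W] is at most twice that of [V], hence [e / 2]. *)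
  have [d d0 H] := Vac (e / 2) (divr_gt0 e0 (ltr0n _ 2)).
  exists d => // s sf; have := H s sf; have [sle _ _] := sf => h.
  apply: (@le_trans _ _ (2 * \sum_(p <- s) (V p.2 - V p.1))); last lra.
  rewrite mulr_sumr big_seq [leRHS]big_seq; apply: ler_sum => p ps.
  have /fV : p.1 <= p.2 by move/allP : sle; apply.
  by rewrite ler_norml => /andP[]; lra.
- by move=> x axb; rewrite subKr cid.
Qed.

End AbsolutelyContinuousVariation.

(** * Densities of absolutely continuous nondecreasing functions *)

Section LebesgueStieltjesDensity.
Context (R : realType).
Notation mu := (@lebesgue_measure R).

(** An open interval is the interior of its hull, and finite measure rules out the unbounded
    hulls. *)
Lemma open_intervalP (D : set R) : open D -> is_interval D ->
  (mu D < +oo)%E -> D !=set0 ->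
  exists2 p : R * R, p.1 < p.2 & D = `]p.1, p.2[%classic.
Proof.
move=> oD /is_intervalP DE muD [z Dz].
have {}DE : D = [set` Rhull D]^° by rewrite -DE; exact/esym/interior_id.
case: (Rhull D) DE => [[a x|[]] [b y|[]]] DE.
- exists (x, y); last by rewrite DE interior_itv_bnd.
  move: Dz; rewrite DE interior_itv_bnd /= in_itv/= => /andP[]; exact: lt_trans.
all: move: muD Dz; rewrite DE ?interior_itv ?lebesgue_measure_itv /= ?ltry ?ltNyr ?set_itvE ?interior0 //=.
Qed.

Lemma abs_nondecreasing_continuous (W : R -> R) :
  abs_nondecreasing W -> continuous W.
Proof.
move=> [ndW acW] x; apply/cvgrPdist_le => e e0.
have [d d0 H] := acW e e0.
have key y z : y <= z -> z - y < d -> W z - W y <= e.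
  move=> yz zyd; have := H [:: (y, z)]; rewrite big_seq1; apply.
  by split; rewrite /= ?yz ?big_seq1.
near=> t.
have : `|x - t| < d by near: t; exact: cvgr_dist_lt.
case: (leP x t) => xt.
  rewrite distrC ger0_norm ?subr_ge0// => xtd.
  by rewrite distrC ger0_norm ?subr_ge0 ?ndW// key.
rewrite ger0_norm ?subr_ge0 ?(ltW xt)// => xtd.
by rewrite ger0_norm ?subr_ge0 ?ndW ?(ltW xt)// key// ltW.
Unshelve. all: by end_near. Qed.

Lemma lebesgue_stieltjes_itv (F : cumulative R R) (x y : R) : x <= y ->
  lebesgue_stieltjes_measure F `]x, y]%classic = (F y - F x)%:E.
Proof.
move=> xy; rewrite /lebesgue_stieltjes_measure/= /measure_extension.
by rewrite measurable_mu_extE/=; [rewrite wlength_itv_bnd|exact: is_ocitv].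
Qed.

Lemma open_intervals_meet (a b c d : R) : a < b -> c < d -> c < b -> a < d ->
  `]a, b[%classic `&` `]c, d[%classic !=set0.
Proof.
(* The midpoint of the intersection. *)
move=> ab cd cb ad; exists ((Num.max a c + Num.min b d) / 2).
by case: leP => ?; case: leP => ?; split; rewrite /= in_itv/=; apply/andP; split; lra.
Qed.

(** A null set lies in an open set [U] of measure below [d], and [U] is a countable disjoint union
    of open intervals. Any finitely many of them form a short family, on which [F] increases by at
    most [e]; so the Stieltjes measure of [U] is at most [e]. *)
Lemma abs_nondecreasing_dominates (F : cumulative R R) : abs_nondecreasing F ->
  lebesgue_stieltjes_measure F `<< mu.
Proof.
move=> [ndF acF]; apply/null_content_dominatesP => A mA A0.
pose nu : {measure set (measurableTypeR R) -> \bar R} :=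
  lebesgue_stieltjes_measure F.
rewrite -[lebesgue_stieltjes_measure F A]/(nu A).
apply/eqP; rewrite eq_le measure_ge0 andbT; apply/lee_addgt0Pr => e e0.
rewrite add0e; have [d d0 H] := acF e e0.
have Aoo : (mu A < +oo)%E by rewrite [X in (X < _)%E]A0.
have [U [oU AU UA]] := lebesgue_regularity_outer mA Aoo d0.
have mU : measurable (U : set (measurableTypeR R)) by exact: open_measurable.
have Ud : (mu U < d%:E)%E.
  rewrite -(setDUK AU) (le_lt_trans (measureU2 _ _ _))//; first exact: measurableD.
  by rewrite [X in (X + _)%E]A0 add0e.
pose D i := open_disjoint_itv oU i.
have oD i : open (D i) by exact: open_disjoint_itv_open.
have mD i : measurable (D i : set (measurableTypeR R)) by exact: open_measurable.
have iD i : is_interval (D i) by exact: open_disjoint_itv_is_interval.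
have tD : trivIset setT D by exact: open_disjoint_itv_trivIset.
have UE : U = \bigcup_i D i by exact: open_disjoint_itv_bigcup.
have DU i : D i `<=` U by rewrite UE; exact: bigcup_sup.
have /choice[p pE] : forall i, exists p : R * R, D i !=set0 ->
    p.1 < p.2 /\ D i = `]p.1, p.2[%classic.
  move=> i; have [D0|] := pselect (D i !=set0); last by exists (0, 0).
  have [|q q12 qE] := open_intervalP (oD i) (iD i) _ D0; last by exists q.
  apply: le_lt_trans (lt_trans Ud (ltry d)).
  by apply: le_measure; rewrite ?inE//; exact: DU.
apply: (@le_trans _ _ (nu U)); first by apply: le_measure; rewrite ?inE//; exact: mA.
rewrite UE measure_semi_bigcup//; last exact: bigcup_measurable.
apply: lime_le; first by apply: is_cvg_nneseries => *; exact: measure_ge0.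
apply: nearW => n.
(* Empty components have no endpoints to enter a family; by [zeroE] dropping them changes no
   measure. *)
pose ns := [seq i <- index_iota 0 n | `[< D i !=set0 >]].
pose s := [seq p i | i <- ns].
have nsP i : i \in ns -> D i !=set0 by rewrite mem_filter => /andP[/asboolP].
have zeroE (m : {measure set (measurableTypeR R) -> \bar R}) :
    (\sum_(0 <= i < n) m (D i) = \sum_(i <- ns) m (D i))%E.
  rewrite /ns big_filter [RHS]big_mkcond/=; apply: eq_bigr => i _.
  case: asboolP => // /nonemptyPn ->; exact: measure0.
have sf : short_family d s.
  split.
  - by apply/allP => _ /mapP[i /nsP /pE[/ltW ? _] ->].
  - rewrite pairwise_map; have : uniq ns by rewrite filter_uniq// iota_uniq.
    rewrite uniq_pairwise; apply: (@sub_in_pairwise _ (mem ns)); last exact/allP.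
    move=> i j /nsP iD0 /nsP jD0 /= ij.
        have [pi Di] := pE i iD0; have [pj Dj] := pE j jD0.
    apply: contraT => /norP[]; rewrite -!ltNge => h1 h2.
    have [z [z1 z2]] : D i `&` D j !=set0.
      by rewrite Di Dj; exact: open_intervals_meet.
    by move: ij; rewrite (tD i j)// ?eqxx//; exists z.
  - rewrite big_map -lte_fin; apply: le_lt_trans Ud.
    rewrite -sumEFin UE measure_semi_bigcup//; last exact: bigcup_measurable.
    apply: le_trans (nneseries_lim_ge n _); last by move=> *; exact: measure_ge0.
    rewrite zeroE big_seq [leRHS]big_seq; apply: lee_sum => i /nsP/pE[pi ->].
    by rewrite [leRHS]lebesgue_measure_itv/= lte_fin pi.
apply: (@le_trans _ _ (\sum_(q <- s) (F q.2 - F q.1))%:E); last first.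
  by rewrite lee_fin; exact: H.
rewrite zeroE -sumEFin big_map big_seq [leRHS]big_seq.
apply: lee_sum => i /nsP/pE[pi ->].
apply: (@le_trans _ _ (nu `](p i).1, (p i).2]%classic)).
  by apply: le_measure; rewrite ?inE//; exact: subset_itvW.
by rewrite [leLHS]lebesgue_stieltjes_itv//; exact: ltW.
Qed.

(** The Stieltjes measure of [W] is restricted to []a, b]] so as to be finite; it is still dominated
    by Lebesgue measure, and its Radon-Nikodym density is the required function. *)
Lemma abs_nondecreasing_density (W : R -> R) (a b : R) : a <= b ->
  abs_nondecreasing W -> exists2 h : R -> R,
    mu.-integrable setT (EFin \o h) &
    forall x y, a <= x -> x <= y -> y <= b ->
      W y - W x = \int[mu]_(t in `]x, y]) h t.
Proof.
move=> ab acW; have [ndW _] := acW.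
have rcW := right_continuousW (abs_nondecreasing_continuous acW).
pose F : cumulative R R := HB.pack W (isCumulative.Build R _ R W ndW rcW).
have mab : measurable (`]a, b]%classic : set (measurableTypeR R)).
  exact: measurable_itv.
have nuD : (lebesgue_stieltjes_measure F `]a, b]%classic < +oo)%E.
  by rewrite lebesgue_stieltjes_itv// ltry.
pose nu : {finite_measure set (measurableTypeR R) -> \bar R} :=
  mfrestr mab nuD.
have numu : nu `<< mu.
  apply/null_content_dominatesP => A mA A0; apply/eqP.
  rewrite eq_le measure_ge0 andbT.
  have /null_content_dominatesP/(_ A mA A0) <- := @abs_nondecreasing_dominates F acW.
  by apply: le_measure; rewrite ?inE//; exact: measurableI.
have [h [h0 hf ih hE]] := radon_nikodym_sigma_finite numu.
exists (fine \o h).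
  by apply: eq_integrable ih => // x _ /=; rewrite fineK.
move=> x y ax xy yb.
have : nu `]x, y]%classic = (W y - W x)%:E.
  rewrite -(@lebesgue_stieltjes_itv F)// /nu /= /mfrestr /mrestr setIidl//.
  by move=> z /=; rewrite !in_itv/= => /andP[xz zy]; rewrite (le_lt_trans ax)// (le_trans zy).
rewrite hE// => h'; rewrite /Rintegral.
under eq_integral do rewrite /= fineK//.
by rewrite h'.
Qed.

End LebesgueStieltjesDensity.

(** * Fundamental theorem of calculus *)

Section AbsolutelyContinuousFTC.
Context (R : realType).
Notation mu := (@lebesgue_measure R).

Lemma near_add_cst_derive1 (F P : R -> R) (c x : R) : derivable F x 1 ->
  {near x, (fun y => F y + c) =1 P} ->
  derivable P x 1 /\ derive1 P x = derive1 F x.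
Proof.
move=> dF FP; have dc : derivable (cst c : R -> R) x 1 by exact: derivable_cst.
split; first exact: near_eq_derivable FP (derivableD dF dc).
rewrite !derive1E -(near_eq_derive _ FP) (deriveD dF dc).
by rewrite [X in _ + X]derive_cst addr0.
Qed.

(** Near [x], [P] differs by the constant [P a] from the integral of [h] starting at [a], which is
    differentiable at Lebesgue points. *)
Lemma primitive_derive1 (P h : R -> R) (a b x : R) : a < x < b ->
  mu.-integrable `]a, b] (EFin \o h) ->
  (forall y, a <= y <= b -> P y - P a = \int[mu]_(t in `]a, y]) h t) ->
  lebesgue_pt h x -> derivable P x 1 /\ derive1 P x = h x.
Proof.
move=> /andP[ax xb] ih PE hx.
have abx : (BRight a < BRight x)%O by rewrite bnd_simp.
have [dF F'] := FTC1_lebesgue_pt xb ih abx hx.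
set F := (fun y => _) in dF F'.
have PF : {near x, (fun y => F y + P a) =1 P}.
  have : x \in `]a, b[ by rewrite in_itv/= ax xb.
  move=> /near_in_itvoo; apply: filterS => y; rewrite in_itv/= => /andP[ay yb].
  by rewrite /F -PE ?(ltW ay) ?(ltW yb)// subrK.
by have [? ->] := near_add_cst_derive1 dF PF.
Qed.

(** The difference [h] of the densities of the two monotone parts satisfies the formula. At Lebesgue
    points of [h], hence almost everywhere, it is the derivative of [g], that is, [F]. *)
Lemma abs_continuous_integral (g F : R -> R) : abs_continuous g ->
  mu.-integrable setT (EFin \o F) -> {ae mu, forall x, derive1 g x = F x} ->
  forall a b, a <= b -> g b - g a = \int[mu]_(t in `]a, b]) F t.
Proof.
(* On the enlarged interval every point of []a, b]], including [b], is interior, as differentiation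
   requires. *)
move=> acg iF gF a b ab; have ab1 : a <= b + 1 by lra.
have [V [W [acV acW gVW]]] := abs_continuous_nondecreasing acg ab1.
have [v iv vE] := abs_nondecreasing_density ab1 acV.
have [w iw wE] := abs_nondecreasing_density ab1 acW.
pose h x := v x - w x.
have ih : mu.-integrable setT (EFin \o h).
  have -> : EFin \o h = ((EFin \o v) \- (EFin \o w))%E by apply/funext.
  exact: integrableB.
have ihS (A : set R) : measurable (A : set (measurableTypeR R)) ->
    mu.-integrable A (EFin \o h).
  by move=> mA; apply: integrableS ih.
have gE x : a <= x <= b + 1 -> g x - g a = \int[mu]_(t in `]a, x]) h t.
  move=> /andP[ax xb]; rewrite RintegralB//; last 2 first.
  - by apply: integrableS iv => //; exact: measurable_itv.
  - by apply: integrableS iw => //; exact: measurable_itv.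
  by rewrite -vE// -wE// !gVW ?lexx ?ax ?xb ?ab1//; ring.
have locf : locally_integrable [set: R] h.
  by apply: open_integrable_locally => //; exact: openT.
rewrite (gE b) ?ab ?lerDl ?ler01//.
congr fine; apply: ae_eq_integral.
- exact: measurable_itv.
- by case/integrableP : (ihS `]a, b]%classic (measurable_itv _)).
- by apply: measurable_funS (measurable_int _ iF).
have fF := ae_filter_ringOfSetsType mu.
apply: filterS2 gF (lebesgue_differentiation locf) => x gF hx /=.
rewrite in_itv/= => /andP[ax xb]; congr EFin.
have axb : a < x < b + 1 by rewrite ax (le_lt_trans xb)// ltrDl.
by have [_ <-] := primitive_derive1 axb (ihS _ (measurable_itv _)) gE hx.
Qed.
End AbsolutelyContinuousFTC.

(** * Convolution with a measure *)

Section Convolution.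
Context (R : realType).
Notation mu := (@lebesgue_measure R).
Notation TR := (measurableTypeR R).
Implicit Types (m : posball R) (F : R -> R).

Lemma measurable_shift (y : R) :
  measurable_fun [set: TR] (fun x : TR => (x - y : TR)).
Proof. exact: measurable_funB. Qed.

(** The pushforward under a translation agrees with Lebesgue measure on half-open intervals, which
    determine it. *)
Lemma lebesgue_measure_shift (y : R) (A : set TR) : measurable A ->
  mu A = pushforward mu (fun x : TR => (x - y : TR)) A.
Proof.
move=> mA; pose sh : {mfun TR >-> TR} :=
  HB.pack (fun x : TR => (x - y : TR))
    (isMeasurableFun.Build _ _ _ _ _ (measurable_shift y)).
rewrite -[X in pushforward mu X A]/(sh : TR -> TR).
apply: (@lebesgue_measure_unique _ (pushforward mu sh)) => // _ [[a b] _ <-] /=.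
rewrite /pushforward (_ : _ @^-1` _ = `]a + y, b + y]%classic); last first.
  by apply/seteqP; split => x /=; rewrite !in_itv/= ltrBrDr lerBlDr.
rewrite !lebesgue_measure_itv/= !lte_fin ltrD2r; case: ifPn => // _.
by rewrite -!EFinB; congr EFin; ring.
Qed.

Lemma ge0_integral_shift (y : R) (f : TR -> \bar R) :
  measurable_fun setT f -> (forall x, 0 <= f x)%E ->
  (\int[mu]_x f (x - y)%R = \int[mu]_x f x)%E.
Proof.
move=> mf f0.
have := ge0_integral_pushforward (measurable_shift y) mu measurableT mf (fun x _ => f0 x).
rewrite preimage_setT => <-.
apply: eq_measure_integral; first exact: measurable_shift.
by move=> ? A mA _; have := lebesgue_measure_shift y mA.
Qed.

Lemma integral_shift (y : R) (D : set TR) (f : TR -> \bar R) :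
  measurable D -> measurable_fun setT f ->
  (\int[mu]_(x in (fun x : TR => (x - y)%R : TR) @^-1` D) f (x - y)%R =
   \int[mu]_(x in D) f x)%E.
Proof.
move=> mD mf; have ge0 (g : TR -> \bar R) : (forall x, 0 <= g x)%E -> measurable_fun setT g ->
  (\int[mu]_(x in (fun x : TR => (x - y)%R : TR) @^-1` D) g (x - y)%R =
   \int[mu]_(x in D) g x)%E.
  move=> g0 mg; rewrite [RHS]integral_mkcond -(@ge0_integral_shift y); last 2 first.
  - by apply/(measurable_restrictT _ _).1 => //; exact: measurable_funTS.
  - by move=> x; rewrite patchE; case: ifP.
  rewrite [LHS]integral_mkcond; apply: eq_integral => x _.
  by rewrite !patchE; congr (if _ then _ else _).
rewrite integralE [RHS]integralE; congr (_ - _)%E.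
  rewrite -(ge0 (f ^\+)%E) //; last exact: measurable_funepos.
  by apply: eq_integral => x _; rewrite !funeposE.
rewrite -(ge0 (f ^\-)%E) //; last exact: measurable_funeneg.
by apply: eq_integral => x _; rewrite !funenegE.
Qed.

Lemma measurable_convolution_kernel (f : TR -> \bar R) :
  measurable_fun setT f -> measurable_fun setT (fun p : TR * TR => f (p.1 - p.2)%R).
Proof.
move=> mf; apply: (measurableT_comp mf).
by apply: measurable_funB; [exact: measurable_fst|exact: measurable_snd].
Qed.

Lemma measurable_subl (x : R) : measurable_fun [set: TR] (fun y : TR => (x - y : TR)).
Proof. by apply: measurable_funB. Qed.

Lemma ge0_measurable_convolution m (f : TR -> \bar R) :
  measurable_fun setT f -> (forall x, 0 <= f x)%E ->
  measurable_fun [set: TR] (fun x : TR => \int[m]_y f (x - y)%R)%E.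
Proof.
move=> mf f0.
exact: (@measurable_fun_fubini_tonelli_F _ _ TR TR R m _ (measurable_convolution_kernel mf)).
Qed.

Lemma measurable_convolution m F : measurable_fun [set: TR] F ->
  measurable_fun [set: TR] (convolution F m).
Proof.
move=> mF; rewrite /convolution /Rintegral.
apply: (measurableT_comp (fine_measurable measurableT)).
have mEF : measurable_fun [set: TR] (EFin \o F) by exact/measurable_EFinP.
pose p := ((EFin \o F)^\+)%E; pose q := ((EFin \o F)^\-)%E.
rewrite (_ : (fun _ => _) = (fun x : TR => \int[m]_y p (x - y)%R) \-
    (fun x : TR => \int[m]_y q (x - y)%R))%E; last first.
  apply/funext => x; rewrite integralE; congr (_ - _)%E; apply: eq_integral => y _.
    by rewrite /p !funeposE.
  by rewrite /q !funenegE.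
apply: emeasurable_funB.
  by apply: ge0_measurable_convolution => [|x]; [exact: measurable_funepos|exact: funepos_ge0].
by apply: ge0_measurable_convolution => [|x]; [exact: measurable_funeneg|exact: funeneg_ge0].
Qed.

(** By Tonelli and translation invariance the left side is the integral of [f] times the mass of
    [m]. Applied to the absolute value of a kernel error, the bound is uniform in [m]. *)
Lemma ge0_integral_convolution_le m (f : TR -> \bar R) :
  measurable_fun setT f -> (forall x, 0 <= f x)%E ->
  (\int[mu]_x \int[m]_y f (x - y)%R <= \int[mu]_x f x)%E.
Proof.
move=> mf f0.
have := @fubini_tonelli _ _ TR TR R mu m _ (measurable_convolution_kernel mf) (fun p => f0 _).
rewrite /fubini_F /fubini_G /= => ->.
under eq_integral do rewrite ge0_integral_shift//.
rewrite integral_cst//= -[leRHS]mule1; apply: lee_wpmul2l.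
  exact: integral_ge0.
exact: sprobability_setT.
Qed.

End Convolution.

(** * Derivatives of convolutions *)

Section ConvolutionDerivative.
Context (R : realType).
Notation mu := (@lebesgue_measure R).
Notation TR := (measurableTypeR R).
Implicit Types (m : posball R) (F g : R -> R).

Lemma integral_cst_posball_le m (M : R) : 0 <= M ->
  (\int[m]_(y in [set: TR]) M%:E <= M%:E)%E.
Proof.
move=> M0; rewrite integral_cst// -[leRHS]mule1; apply: lee_wpmul2l.
  by rewrite lee_fin.
exact: sprobability_setT.
Qed.

Lemma bounded_integrable_posball m F (M : R) : measurable_fun [set: TR] F ->
  (forall x, `|F x| <= M) -> m.-integrable [set: TR] (EFin \o F).
Proof.
move=> mF FM; have M0 : 0 <= M by apply: le_trans (FM 0); exact: normr_ge0.
apply/integrableP; split; first exact/measurable_EFinP.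
apply: le_lt_trans (ltry M); apply: le_trans (integral_cst_posball_le m M0).
by apply: ge0_le_integral_lower => x _ //=; rewrite lee_fin.
Qed.

Lemma bounded_shift_integrable m F (M x : R) : measurable_fun [set: TR] F ->
  (forall x, `|F x| <= M) -> m.-integrable [set: TR] (fun y : TR => (F (x - y))%:E).
Proof.
move=> mF FM; apply: (@bounded_integrable_posball m (fun y => F (x - y)) M) => //.
by apply: (measurableT_comp mF); exact: measurable_subl.
Qed.

Lemma normr_convolution_le m F (M x : R) : (forall x, `|F x| <= M) ->
  `|convolution F m x| <= M.
Proof.
move=> FM; have M0 : 0 <= M by apply: le_trans (FM 0); exact: normr_ge0.
apply: normr_Rintegral_le; apply: le_trans (integral_cst_posball_le m M0).
by apply: ge0_le_integral_lower => y _ //=; rewrite lee_fin.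
Qed.

(** Fubini for [F (x - y)] with [x] in []a, b]]: integrating in [x] first gives
    [g (b - y) - g (a - y)]. *)
Lemma convolution_primitive m F g (M N : R) :
  mu.-integrable [set: TR] (EFin \o F) -> (forall x, `|F x| <= M) ->
  measurable_fun [set: TR] g -> (forall x, `|g x| <= N) ->
  (forall a b, a <= b -> g b - g a = \int[mu]_(t in `]a, b]) F t) ->
  forall a b, a <= b ->
    convolution g m b - convolution g m a = \int[mu]_(t in `]a, b]) convolution F m t.
Proof.
move=> iF FM mg gN gF a b ab.
have mF : measurable_fun [set: TR] F.
  by apply/measurable_EFinP; exact: measurable_int iF.
have M0 : 0 <= M by apply: le_trans (FM 0); exact: normr_ge0.
pose D : set TR := `]a, b]%classic.
have mD : measurable D by exact: measurable_itv.
pose f (p : TR * TR) : \bar R := if p.1 \in D then (F (p.1 - p.2))%:E else 0%E.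
have mEF : measurable_fun [set: TR] (EFin \o F) by exact/measurable_EFinP.
have mf : measurable_fun setT f.
  apply: measurable_fun_ifT => //; last exact: measurable_convolution_kernel mEF.
  apply: (measurableT_comp _ measurable_fst).
  by apply: (measurable_fun_bool true); rewrite setTI preimage_mem_true.
(* The integrand is bounded by [M] and lives on a strip of finite product measure. *)
have fi : (mu \x m)%E.-integrable setT f.
  apply/integrable12ltyP => //.
  apply: (@le_lt_trans _ _ (\int[mu]_(x in D) M%:E)%E); last first.
    rewrite integral_cst// [X in (_ * X)%E]lebesgue_measure_itv/=.
    by case: ifPn => _; rewrite -?EFinB -?EFinM ?mule0 ltry.
  rewrite [leRHS]integral_mkcond; apply: ge0_le_integral_lower => x _.
    by apply: integral_ge0 => y _; exact: abse_ge0.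
  rewrite patchE /f /=; case: ifPn => xD; last by rewrite integral0_eq// => y _; exact: abse0.
  apply: le_trans (integral_cst_posball_le m M0).
  by apply: ge0_le_integral_lower => y _ //=; rewrite lee_fin.
have := Fubini fi.
rewrite [X in X = _ -> _](_ : _ = (\int[mu]_(x in D) (convolution F m x)%:E)%E); last first.
  rewrite [RHS]integral_mkcond; apply: eq_integral => x _.
  rewrite patchE /f /=; case: ifPn => xD; last by rewrite integral0.
  rewrite /convolution /Rintegral fineK//.
  by apply: integrable_fin_num => //; exact: bounded_shift_integrable FM.
rewrite [X in _ = X -> _](_ : _ = (\int[m]_y (g (b - y) - g (a - y))%:E)%E); last first.
  apply: eq_integral => y _.
  rewrite gF ?lerD2r// /Rintegral fineK; last first.
    apply: integrable_fin_num; first exact: measurable_itv.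
    exact: integrableS iF.
  rewrite -(@integral_shift _ y _ (EFin \o F)) //.
  rewrite (_ : _ @^-1` _ = D); last first.
    by apply/seteqP; split => x /=; rewrite !in_itv/= ltrD2r lerD2r.
  by rewrite [RHS]integral_mkcond; apply: eq_integral => x _; rewrite patchE.
rewrite /convolution -RintegralB//; last 2 first.
- exact: bounded_shift_integrable gN.
- exact: bounded_shift_integrable gN.
by rewrite /Rintegral => ->.
Qed.


Lemma bounded_locally_integrable F (M : R) : measurable_fun [set: TR] F ->
  (forall x, `|F x| <= M) -> locally_integrable [set: R] F.
Proof.
move=> mF FM; split => //; first exact: openT.
move=> K _ cK; apply: (@le_lt_trans _ _ (\int[mu]_(x in K) M%:E)%E).
  by apply: ge0_le_integral_lower => x _ /=; rewrite lee_fin.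
rewrite integral_cst; last exact: compact_measurable.
by rewrite lte_mul_pinfty ?lee_fin ?(le_trans _ (FM 0))//; exact: compact_finite_measure.
Qed.

Lemma bounded_integrable_itv F (M a b : R) : measurable_fun [set: TR] F ->
  (forall x, `|F x| <= M) -> mu.-integrable `]a, b] (EFin \o F).
Proof.
move=> mF FM; apply: measurable_bounded_integrable => //.
- by rewrite [X in (X < _)%E]lebesgue_measure_itv/=; case: ifPn => _; rewrite -?EFinB ltry.
- exact: measurable_funTS.
- by exists M; split; rewrite ?num_real// => z Mz x _; rewrite /= (le_trans (FM x))// ltW.
Qed.

Section Derivative.
Variables (m : posball R) (F g : R -> R) (M N : R).
Hypotheses (iF : mu.-integrable [set: TR] (EFin \o F)) (FM : forall x, `|F x| <= M).
Hypotheses (mg : measurable_fun [set: TR] g) (gN : forall x, `|g x| <= N).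
Hypothesis gF : forall a b, a <= b -> g b - g a = \int[mu]_(t in `]a, b]) F t.

Let mF : measurable_fun [set: TR] F.
Proof. by apply/measurable_EFinP; exact: measurable_int iF. Qed.

Let mcF : measurable_fun [set: TR] (convolution F m).
Proof. exact: measurable_convolution. Qed.

(** By [convolution_primitive], [primitive_derive1] applies on the interval from [x - 1] to
    [x + 1]. *)
Lemma convolution_lebesgue_pt x : lebesgue_pt (convolution F m) x ->
  derivable (convolution g m) x 1 /\ derive1 (convolution g m) x = convolution F m x.
Proof.
have x1 : x - 1 < x < x + 1 by rewrite ltrDl ltrBlDr ltrDl ltr01.
apply: (primitive_derive1 x1).
  by apply: bounded_integrable_itv => // z; exact: normr_convolution_le FM.
by move=> y /andP[xy _]; exact: (convolution_primitive m iF FM mg gN gF).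
Qed.

Lemma convolution_derive1_ae :
  {ae mu, forall x, derive1 (convolution g m) x = convolution F m x}.
Proof.
have cFM x : `|convolution F m x| <= M by exact: normr_convolution_le.
have := lebesgue_differentiation (bounded_locally_integrable mcF cFM).
apply: filterS; first exact: (ae_filter_ringOfSetsType mu).
by move=> x /convolution_lebesgue_pt[].
Qed.

Lemma convolution_continuous : continuous F -> continuous (convolution F m).
Proof.
move=> cF x.
have M0 : 0 <= M by apply: le_trans (FM 0); exact: normr_ge0.
have := @continuity_under_integral R _ TR m (fun x y => F (x - y)) setT measurableT
  (x - 1) (x + 1) _ _ (cst M) _ _.
apply.
- by move=> z _; exact: bounded_shift_integrable FM.
- apply: aeW => y _ z _; apply: continuous_comp; last exact: cF.
  by apply: cvgB; [exact: cvg_id|exact: cvg_cst].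
- by apply: (@bounded_integrable_posball m (cst M) M) => // z; rewrite ger0_norm.
- by move=> z _; apply: aeW => y _; exact: FM.
- by rewrite inE/= in_itv/= ltrDl ltrBlDr ltrDl ltr01.
Qed.

(** When [F] is continuous so is its convolution, and every point is a Lebesgue point. *)
Lemma convolution_derive1 : continuous F -> forall x,
  derive1 (convolution g m) x = convolution F m x.
Proof.
move=> cF x; suff /convolution_lebesgue_pt[] : lebesgue_pt (convolution F m) x by [].
apply: (@continuous_lebesgue_pt _ _ _ setT) => //.
- by split => //; exact: openT.
- exact: convolution_continuous.
Qed.

End Derivative.

End ConvolutionDerivative.

(** * Regular kernels *)

Section Kernel.
Context (R : realType).
Notation mu := (@lebesgue_measure R).
Notation TR := (measurableTypeR R).
Implicit Types (m : posball R) (F G g : R -> R).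

Lemma abs_continuous_continuous g : abs_continuous g -> continuous g.
Proof.
move=> acg x; apply/cvgrPdist_le => e e0.
have [d d0 H] := abs_continuous_family acg e0.
have key y z : y <= z -> z - y < d -> `|g z - g y| <= e.
  move=> yz zyd; have := H [:: (y, z)]; rewrite big_seq1 => h; apply/ltW/h.
  by split; rewrite /= ?yz ?big_seq1.
near=> t.
have : `|x - t| < d by near: t; exact: cvgr_dist_lt.
case: (leP x t) => xt; first by rewrite distrC ger0_norm ?subr_ge0// distrC; exact: key.
by rewrite ger0_norm ?subr_ge0 ?(ltW xt)//; apply: key; exact: ltW.
Unshelve. all: by end_near. Qed.

Lemma continuous_measurable_TR g : continuous g -> measurable_fun [set: TR] g.
Proof. exact: continuous_measurable_fun. Qed.

(** Increments of [g] are bounded by the L1 norm of [F]; comparison with [g 0] bounds [g] itself. *)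
Lemma primitive_bounded F g : mu.-integrable [set: TR] (EFin \o F) ->
  (forall a b, a <= b -> g b - g a = \int[mu]_(t in `]a, b]) F t) ->
  exists M, forall x, `|g x| <= M.
Proof.
move=> iF gF; set I := (\int[mu]_x `|(F x)%:E|)%E.
have If : I \is a fin_num.
  rewrite ge0_fin_numE; first by case/integrableP : iF.
  by apply: integral_ge0 => x _; exact: abse_ge0.
have key a b : a <= b -> `|g b - g a| <= fine I.
  move=> ab; rewrite gF//; apply: normr_Rintegral_le; rewrite fineK//.
  rewrite integral_mkcond; apply: ge0_le_integral_lower => x _.
    by rewrite patchE; case: ifPn => // _; rewrite lee_fin.
  by rewrite patchE; case: ifPn => // _; exact: abse_ge0.
exists (`|g 0| + fine I) => x.
rewrite -[g x](subrK (g 0)) addrC (le_trans (ler_normD _ _))// lerD2l.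
case: (leP 0 x) => x0; first exact: key.
by rewrite distrC; apply: key; exact: ltW.
Qed.

Lemma BVR_bounded F : BVR F -> exists M, forall x, `|F x| <= M.
Proof.
move=> [_]; set S := ereal_sup _ => Soo.
have key a b : a <= b -> (`|F b - F a|%:E <= S)%E.
  move=> ab; apply: le_trans (total_variation_ge _ ab) _.
  by apply: ereal_sup_ubound; exists (a, b).
have Sf : S \is a fin_num.
  by rewrite ge0_fin_numE// (le_trans _ (key 0 0 _))// lee_fin.
exists (`|F 0| + fine S) => x.
rewrite -[F x](subrK (F 0)) addrC (le_trans (ler_normD _ _))// lerD2l.
rewrite -lee_fin fineK//.
case: (leP 0 x) => x0; first exact: key.
by rewrite distrC; apply: key; exact: ltW.
Qed.

(** Since [m] may charge Lebesgue null sets, equality can fail at some points. But the indicator of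
    the null set [N] has integral 0, hence so does its convolution with [m]: for almost every [x],
    the set of [y] with [x - y] in [N] is [m]-null. *)
Lemma convolution_ae_eq m G F : measurable_fun [set: TR] F ->
  {ae mu, forall x, G x = F x} ->
  {ae mu, forall x, convolution G m x = convolution F m x}.
Proof.
move=> mF [N [mN N0 subN]].
pose f (x : TR) : \bar R := (\1_N x)%:E.
have mf : measurable_fun [set: TR] f by exact/measurable_EFinP/measurable_indic.
have f0 x : (0 <= f x)%E by rewrite lee_fin.
have mc := ge0_measurable_convolution m mf f0.
have : (\int[mu]_x `|\int[m]_y f (x - y)%R| = 0)%E.
  apply/eqP; rewrite eq_le integral_ge0 ?andbT; last by move=> *; exact: abse_ge0.
  under eq_integral do rewrite gee0_abs ?integral_ge0//.
  apply: le_trans (ge0_integral_convolution_le m mf f0) _.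
  by rewrite integral_indic// setIT [leLHS]N0.
move/(ae_eq_integral_abs mu measurableT mc).1 => ae0.
have fF := ae_filter_ringOfSetsType mu.
apply: filterS ae0 => x /(_ I) cx0; rewrite /convolution.
apply: ae_eq_Rintegral_lower.
  by apply: (measurableT_comp mF); exact: measurable_subl.
have mNx : measurable ((fun y : TR => (x - y : TR)) @^-1` N).
  by rewrite -[X in measurable X]setTI; exact: measurable_subl.
exists ((fun y : TR => (x - y : TR)) @^-1` N); split => //.
  transitivity (\int[m]_y f (x - y)%R)%E => //.
  have := integral_indic m measurableT mNx; rewrite setIT => <-.
  by apply: eq_integral => y _; rewrite /f !indicE.
by move=> y /= h; apply: subN.
Qed.

(** Treats at once the orders where the next derivative is itself integrable and the order [n - 1],
    where [F] is the BV representative. *)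
Lemma kernel_derive_primitive n G k : kernel_regular n G -> (k < n)%N ->
  forall F, mu.-integrable [set: TR] (EFin \o F) ->
  {ae mu, forall x, derive1n k.+1 G x = F x} ->
  [/\ continuous (derive1n k G), exists M, forall x, `|derive1n k G x| <= M &
    forall a b, a <= b -> derive1n k G b - derive1n k G a = \int[mu]_(t in `]a, b]) F t].
Proof.
move=> [_ acG _ _] kn F iF GF; have GkF := abs_continuous_integral (acG k kn) iF GF.
by split => //; [exact: abs_continuous_continuous (acG k kn)|exact: primitive_bounded GkF].
Qed.

Lemma derive1n_convolution n G k m : kernel_regular n G -> (k < n)%N ->
  derive1n k (convolution G m) = convolution (derive1n k G) m.
Proof.
move=> Greg; have [_ _ iG [F [iF _] GF]] := Greg.
elim: k => // k IH kn; have {}IH := IH (ltnW kn).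
have [cGk [M GkM] GkE] := kernel_derive_primitive Greg (ltnW kn) (iG _ kn) (aeW _ (fun x => erefl)).
(* The derivative of order [k + 1] is bounded as a primitive: of the classical next derivative if
   [k + 2 < n], of the BV representative if [k + 2 = n]. *)
have [cGk1 [M1 Gk1M]] : continuous (derive1n k.+1 G) /\ exists M, forall x, `|derive1n k.+1 G x| <= M.
  have [kn'|nk] := ltnP k.+2 n.
    by have [] := kernel_derive_primitive Greg kn (iG _ kn') (aeW _ (fun x => erefl)).
  have {}nk : n = k.+2 by apply/eqP; rewrite eqn_leq nk kn.
  by rewrite nk in GF; have [] := kernel_derive_primitive Greg kn iF GF.
rewrite derive1nS IH; apply/funext => x.
exact: (convolution_derive1 m (iG _ kn) Gk1M (continuous_measurable_TR cGk) GkM GkE cGk1).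
Qed.

(** The kernel [F] and the bound [M] are chosen before [m], which gives uniformity in [N] and [t].
    For [k = n] the kernel is the BV representative: if [n = 0], kernels equal almost everywhere are
    exchanged; otherwise the convolution of order [n - 1] is differentiated at Lebesgue points. *)
Lemma derive1n_convolution_ae n G k : kernel_regular n G -> (k <= n)%N ->
  exists F M, [/\ mu.-integrable [set: TR] (EFin \o F), forall x, `|F x| <= M &
    forall m, {ae mu, forall x, derive1n k (convolution G m) x = convolution F m x}].
Proof.
move=> Greg; have [_ _ iG [F [iF BVF] GF]] := Greg.
rewrite leq_eqVlt => /predU1P[->|kn]; last first.
  suff [M GkM] : exists M, forall x, `|derive1n k G x| <= M.
    exists (derive1n k G), M; split => //; first exact: iG.
    by move=> m; rewrite (derive1n_convolution m Greg kn); exact: aeW.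
  have [kn'|nk] := ltnP k.+1 n.
    by have [] := kernel_derive_primitive Greg kn (iG _ kn') (aeW _ (fun x => erefl)).
  have {}nk : n = k.+1 by apply/eqP; rewrite eqn_leq nk kn.
  by rewrite nk in GF; have [] := kernel_derive_primitive Greg kn iF GF.
have [M FM] := BVR_bounded (conj iF BVF).
exists F, M; split => // m; case: n Greg GF {iG} => [|k'] Greg GF.
  apply: convolution_ae_eq GF.
  by apply/measurable_EFinP; exact: measurable_int iF.
have [cG [M' GM'] GE] := kernel_derive_primitive Greg (ltnSn k') iF GF.
rewrite derive1nS (derive1n_convolution m Greg (ltnSn k')).
exact: (convolution_derive1_ae m iF FM (continuous_measurable_TR cG) GM' GE).
Qed.

End Kernel.

(** * Convergence in L1 of convolutions *)

Section L1Approximation.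
Context (R : realType).
Notation mu := (@lebesgue_measure R).
Notation TR := (measurableTypeR R).
Implicit Types (m : posball R) (F : R -> R).

Lemma cvge0_near (u : nat -> \bar R) : (u n @[n --> \oo] --> 0)%E ->
  forall e : R, 0 < e -> \forall n \near \oo, (u n <= e%:E)%E.
Proof.
move=> /fine_cvgP[uf u0] e e0; near=> n.
have uff : u n \is a fin_num by near: n.
rewrite -(fineK uff) lee_fin (le_trans (ler_norm _))//.
rewrite -[fine (u n)]subr0 distrC; near: n.
by move/cvgrPdist_le : u0; exact.
Unshelve. all: by end_near. Qed.

Definition tail (F : R -> R) (n : nat) (x : R) : R :=
  if n%:R < `|x| then `|F x| else 0.

Lemma tail_ge0 F n x : 0 <= tail F n x.
Proof. by rewrite /tail; case: ifP. Qed.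

Lemma integrable_tail F (e : R) : mu.-integrable [set: TR] (EFin \o F) -> 0 < e ->
  exists n : nat, (\int[mu]_x (tail F n x)%:E <= e%:E)%E.
Proof.
move=> iF e0.
have : ((\int[mu]_(x in setT) (tail F n x)%:E) @[n --> \oo] --> 0)%E.
  apply: (@dominated_cvg0_lower _ TR R mu setT _ (fun x => `|F x|)) => //.
  - by move=> n x _; exact: tail_ge0.
  - by move=> n x _; rewrite /tail; case: ifP.
  - by have := integrable_norm iF.
  - move=> x _; apply: cvg_near_cst; near=> n.
    rewrite /tail ltNge (_ : `|x| <= n%:R)//; near: n; exact: nbhs_infty_ger.
move/cvge0_near => /(_ e e0) [n _ /(_ n (leqnn _))]; by exists n.
Unshelve. all: by end_near. Qed.

Lemma C0_compact_support (f : R -> R) (X : R) : continuous f ->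
  (forall x, X < `|x| -> f x = 0) -> C0 f.
Proof.
move=> cf f0; split => //; apply: cvg_near_cst; near=> x; apply: f0.
  apply: lt_le_trans (ler_norm _).
  by near: x; apply: nbhs_pinfty_gt; exact: num_real.
rewrite -normrN; apply: lt_le_trans (ler_norm _); rewrite ltrNr.
by near: x; apply: nbhs_ninfty_lt; exact: num_real.
Unshelve. all: by end_near. Qed.

Lemma compact_support_bounded (f : R -> R) (X : R) : continuous f ->
  (forall x, X < `|x| -> f x = 0) -> exists M, forall x, `|f x| <= M.
Proof.
move=> cf f0.
have [M [_ HM]] : bounded_set (f @` `[- X, X]).
  apply: compact_bounded; apply: continuous_compact.
    exact: continuous_subspaceT.
  exact: segment_compact.
exists (Num.max 0 (M + 1)) => x; rewrite le_max.
have [xX|Xx] := leP `|x| X; last by rewrite f0// normr0 lexx.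
apply/orP; right; apply: (HM (M + 1)); first by rewrite ltrDl.
by exists x => //=; rewrite in_itv/= -ler_norml.
Qed.

Lemma integrable_continuous_approx F (e : R) : mu.-integrable [set: TR] (EFin \o F) -> 0 < e ->
  exists (phi : R -> R) (X : R), [/\ continuous phi, forall x, X < `|x| -> phi x = 0 &
    (\int[mu]_x `|F x - phi x|%:E <= e%:E)%E].
Proof.
move=> iF e0; have e20 : 0 < e / 2 by rewrite divr_gt0.
have mF : measurable_fun [set: TR] F by apply/measurable_EFinP; exact: measurable_int iF.
have [n Fn] := integrable_tail iF e20.
pose E : set TR := `[- n.+1%:R, n.+1%:R]%classic.
have mE : measurable E by exact: measurable_itv.
have Eoo : (mu E < +oo)%E.
  by rewrite [X in (X < _)%E]lebesgue_measure_itv/=; case: ifPn => _; rewrite -?EFinB ltry.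
have iFE : mu.-integrable E (EFin \o F) by exact: integrableS iF.
have [g_ [cg ig gF]] := approximation_continuous_integrable mE Eoo iFE.
have [k _ /(_ k (leqnn _)) gk] := cvge0_near gF e20.
(* A piecewise linear cut-off, equal to 1 on [[-n, n]] and to 0 outside [E]. *)
pose eta (x : R) := Num.max 0 (Num.min 1 (n.+1%:R - `|x|)).
have eta01 x : 0 <= eta x <= 1.
  by rewrite /eta le_max lexx /= ge_max ler01 ge_min lexx.
have eta1 x : `|x| <= n%:R -> eta x = 1.
  by move=> xn; rewrite /eta min_l ?max_r ?ler01// lerBrDr -natr1 addrC lerD2r.
have eta0 x : n.+1%:R < `|x| -> eta x = 0.
  by move=> xn; rewrite /eta min_r ?max_l//; [rewrite subr_le0 ltW|rewrite lerBlDr (le_trans (ltW xn))// lerDr].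
have ceta : continuous eta.
  move=> x.
  have c1 : {for x, continuous (fun y : R => n.+1%:R - `|y|)}.
    by apply: cvgB; [exact: cvg_cst|exact: norm_continuous].
  have cc (c : R) : {for x, continuous (cst c : R -> R)} by exact: cvg_cst.
  exact: (continuous_max (cc 0) (continuous_min (cc 1) c1)).
pose phi x := g_ k x * eta x.
have cphi : continuous phi by move=> x; apply: cvgM; [exact: cg|exact: ceta].
have phi0 x : n.+1%:R < `|x| -> phi x = 0 by move=> /eta0; rewrite /phi => ->; rewrite mulr0.
exists phi, n.+1%:R; split => //.
have mg : measurable_fun [set: TR] (g_ k) by exact: continuous_measurable_TR.
pose a (x : TR) := (tail F n x)%:E : \bar R.
pose b := ((fun x : TR => `|(F x - g_ k x)%:E|) \_ E)%E.
apply: (@le_trans _ _ (\int[mu]_x (a x + b x))%E).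
  apply: ge0_le_integral_lower => x _; first by rewrite lee_fin.
  rewrite /a /b patchE; case: ifPn => xE.
    rewrite -EFinD lee_fin /phi /tail.
    case: ltP => [nx|xn]; last by rewrite eta1// mulr1 add0r.
    (* The first term is controlled by the tail of [F], the second by the approximation error on
       [E]. *)
    rewrite (_ : F x - _ = F x * (1 - eta x) + (F x - g_ k x) * eta x); last by ring.
    rewrite (le_trans (ler_normD _ _))// !normrM lerD//; apply: ler_piMr => //;
      have := eta01 x; rewrite ler_norml; lra.
  have nx : n.+1%:R < `|x|.
    by rewrite ltNge; apply: contra xE; rewrite ler_norml inE /E /= in_itv.
  by rewrite adde0 lee_fin /tail phi0// subr0 (lt_trans _ nx)// ltr_nat.
rewrite ge0_integralD//; last 4 first.
- by move=> x _; rewrite lee_fin tail_ge0.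
- apply/measurable_EFinP; apply: measurable_fun_ifT.
  + apply: measurable_fun_ltr => //; exact: measurable_normr.
  + exact: measurableT_comp.
  + exact: measurable_cst.
- by move=> x _; rewrite /b patchE; case: ifPn => // _; exact: abse_ge0.
- apply/(measurable_restrictT _ _).1 => //; apply: measurable_funTS.
  by apply/measurable_EFinP; apply: measurableT_comp => //; exact: measurable_funB.
rewrite [e]splitr EFinD; apply: leeD => //.
by rewrite -integral_mkcond.
Qed.

(** For fixed [x] the function [phi (x - y)] of [y] is continuous and vanishes for [|y| > X + |x|],
    so it is an admissible test function. *)
Lemma convolution_cvg (mN : nat -> posball R) m (phi : R -> R) (X : R) :
  continuous phi -> (forall x, X < `|x| -> phi x = 0) -> weak_star_cvg mN m ->
  forall x, convolution phi (mN n) x @[n --> \oo] --> convolution phi m x.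
Proof.
move=> cphi phi0 mNm x; apply: mNm.
apply: (@C0_compact_support _ (X + `|x|)).
  move=> y; apply: continuous_comp; last exact: cphi.
  by apply: cvgB; [exact: cvg_cst|exact: cvg_id].
move=> y Xxy; apply: phi0; rewrite -(ltrD2r `|x|) (lt_le_trans Xxy)//.
by rewrite distrC -{1}(subrK x y) ler_normD.
Qed.

Lemma convolution_diff_le m F (phi : R -> R) (M Mphi x : R) :
  measurable_fun [set: TR] F -> (forall x, `|F x| <= M) ->
  measurable_fun [set: TR] phi -> (forall x, `|phi x| <= Mphi) ->
  (`|convolution F m x - convolution phi m x|%:E <= \int[m]_y `|F (x - y) - phi (x - y)|%:E)%E.
Proof.
move=> mF FM mphi phiM; rewrite /convolution -RintegralB//; last 2 first.
- exact: bounded_shift_integrable FM.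
- exact: bounded_shift_integrable phiM.
exact: le_normr_Rintegral_lower.
Qed.

(* The kernel is replaced by a compactly supported continuous one up to an error
   that is small in L1, uniformly over measures of mass at most 1. *)
Lemma convolution_L1_cvg (mN : nat -> posball R) m F (M X : R) :
  mu.-integrable [set: TR] (EFin \o F) -> (forall x, `|F x| <= M) ->
  weak_star_cvg mN m -> forall e : R, 0 < e -> \forall n \near \oo,
    (\int[mu]_(x in `[(- X)%R, X]) `|convolution F (mN n) x - convolution F m x|%:E <= e%:E)%E.
Proof.
move=> iF FM mNm e e0; have e30 : 0 < e / 3 by rewrite divr_gt0.
have mF : measurable_fun [set: TR] F by apply/measurable_EFinP; exact: measurable_int iF.
have [phi [Y [cphi phi0 Fphi]]] := integrable_continuous_approx iF e30.
have [L phiL] := compact_support_bounded cphi phi0.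
have L0 : 0 <= L by apply: le_trans (phiL 0); exact: normr_ge0.
have mphi : measurable_fun [set: TR] phi by exact: continuous_measurable_TR.
pose D : set TR := `[- X, X]%classic.
have mD : measurable D by exact: measurable_itv.
pose f (x : TR) : \bar R := `|F x - phi x|%:E.
have mf : measurable_fun [set: TR] f.
  by apply/measurable_EFinP; apply: measurableT_comp => //; exact: measurable_funB.
have f0 x : (0 <= f x)%E by rewrite lee_fin.
(* [A m'] bounds the error of replacing [F] by [phi] for the measure [m']; it is used for [mN n] and
   for [m], and [B n] is the remaining third of the error. *)
pose A m' (x : TR) := (\int[m']_y f (x - y)%R)%E.
have A0 m' x : (0 <= A m' x)%E by exact: integral_ge0.
have mA m' : measurable_fun D (A m').
  by apply: measurable_funTS; exact: ge0_measurable_convolution.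
have AD m' : (\int[mu]_(x in D) A m' x <= (e / 3)%:E)%E.
  apply: le_trans Fphi; apply: le_trans (ge0_integral_convolution_le m' mf f0).
  rewrite integral_mkcond; apply: ge0_le_integral_lower => x _.
    by rewrite patchE; case: ifPn => // _; exact: A0.
  by rewrite patchE; case: ifPn => // _; exact: A0.
pose B n (x : TR) := `|convolution phi (mN n) x - convolution phi m x|.
have mB n : measurable_fun D (EFin \o B n).
  apply: measurable_funTS; apply/measurable_EFinP; apply: measurableT_comp => //.
  by apply: measurable_funB; exact: measurable_convolution.
have Bcvg : ((\int[mu]_(x in D) (B n x)%:E) @[n --> \oo] --> 0)%E.
  apply: (@dominated_cvg0_lower _ TR R mu D _ (cst (L + L))) => //.
  - by move=> n x _; exact: normr_ge0.
  - move=> n x _; rewrite /B (le_trans (ler_normB _ _))// lerD//;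
      exact: normr_convolution_le phiL.
  - apply: measurable_bounded_integrable => //.
    + by rewrite [X in (X < _)%E]lebesgue_measure_itv/=; case: ifPn => _; rewrite -?EFinB ltry.
    + exists (L + L); split; rewrite ?num_real// => z Lz x _ /=.
      by rewrite ger0_norm ?addr_ge0// ltW.
  - move=> x _; rewrite -(normr0 R) -(subrr (convolution phi m x)).
    apply: cvg_norm; apply: cvgB; last exact: cvg_cst.
    exact: (convolution_cvg cphi phi0 mNm).
near=> n.
apply: (@le_trans _ _ (\int[mu]_(x in D) (A (mN n) x + (B n x)%:E + A m x))%E).
  apply: ge0_le_integral_lower => x _; first by rewrite lee_fin.
  have h1 := convolution_diff_le (mN n) x mF FM mphi phiL.
  have h2 := convolution_diff_le m x mF FM mphi phiL.
  apply: le_trans (leeD (leeD h1 (lexx (B n x)%:E)) h2).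
  rewrite -!EFinD lee_fin /B.
  set a := convolution F _ x; set b := convolution F _ x.
  set c := convolution phi _ x; set d := convolution phi _ x.
  rewrite (distrC b d) (_ : a - b = (a - c) + (c - d) + (d - b)); last by ring.
  by rewrite (le_trans (ler_normD _ _))// lerD2r ler_normD.
have AD0 m' x : D x -> (0 <= A m' x)%E by move=> _; exact: A0.
have BD0 x : D x -> (0 <= (B n x)%:E)%E by move=> _; rewrite lee_fin; exact: normr_ge0.
have ABD0 x : D x -> (0 <= A (mN n) x + (B n x)%:E)%E.
  by move=> Dx; apply: adde_ge0; [exact: AD0|exact: BD0].
rewrite (ge0_integralD _ mD ABD0 (emeasurable_funD (mA _) (mB n)) (AD0 m) (mA m)).
rewrite (ge0_integralD _ mD (AD0 (mN n)) (mA _) BD0 (mB n)).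
rewrite (_ : e = e / 3 + e / 3 + e / 3); last by field.
rewrite !EFinD; apply: leeD; last exact: AD.
apply: leeD; first exact: AD.
by near: n; exact: cvge0_near.
Unshelve. all: by end_near. Qed.

End L1Approximation.

(** * Passage to the limit *)

Section TestedPowers.
Context (R : realType).
Notation mu := (@lebesgue_measure R).
Notation TR := (measurableTypeR R).
Implicit Types (m : posball R) (F : R -> R).

Lemma exprn_lipschitz (M : R) (l : nat) : 0 <= M -> exists2 L : R, 0 <= L &
  forall a b, `|a| <= M -> `|b| <= M -> `|a ^+ l - b ^+ l| <= L * `|a - b|.
Proof.
move=> M0; elim: l => [|l [L L0 IH]].
  by exists 0 => // a b _ _; rewrite !expr0 subrr normr0 mul0r.
(* The constant comes from writing the difference as [a (a^l - b^l) + (a - b) b^l]. *)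
exists (M * L + M ^+ l); first by rewrite addr_ge0 ?mulr_ge0 ?exprn_ge0.
move=> a b aM bM.
rewrite !exprS (_ : _ - _ = a * (a ^+ l - b ^+ l) + (a - b) * b ^+ l); last by ring.
rewrite (le_trans (ler_normD _ _))// !normrM mulrDl lerD//.
  by rewrite -mulrA ler_pM// IH.
by rewrite mulrC ler_wpM2r// normrX lerXn2r ?nnegrE.
Qed.

(** Only the dominating function, built from [F] and [G], has to be measurable for the almost
    everywhere comparison; [u], [v] and [f] enter through pointwise bounds. *)
Lemma integral_ae_tested_powers_le (F G u v f : R -> R) (M C X L : R) (l : nat) :
  measurable_fun [set: TR] F -> (forall x, `|F x| <= M) ->
  measurable_fun [set: TR] G -> (forall x, `|G x| <= M) ->
  {ae mu, forall x, u x = F x} -> {ae mu, forall x, v x = G x} ->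
  0 <= L -> (forall a b, `|a| <= M -> `|b| <= M -> `|a ^+ l - b ^+ l| <= L * `|a - b|) ->
  (forall x, `|f x| <= C) -> (forall x, X < `|x| -> f x = 0) ->
  (`|\int[mu]_x ((u x ^+ l - v x ^+ l) * f x)|%:E <=
   (L * C)%:E * \int[mu]_(x in `[(- X)%R, X]) `|F x - G x|%:E)%E.
Proof.
move=> mF FM mG GM uF vG L0 HL fC fX.
have C0 : 0 <= C by apply: le_trans (fC 0); exact: normr_ge0.
have mD : measurable (`[- X, X]%classic : set TR) by exact: measurable_itv.
have mFG : measurable_fun [set: TR] (fun x => `|F x - G x|).
  by apply: measurableT_comp => //; exact: measurable_funB.
apply: le_trans (le_normr_Rintegral_lower _ _ _) _.
rewrite -ge0_integralZl//; last 2 first.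
- by apply: measurable_funTS; exact/measurable_EFinP.
- by rewrite lee_fin mulr_ge0.
rewrite [leRHS]integral_mkcond; apply: ge0_ae_le_integral_lower => //.
- by move=> x _; rewrite patchE; case: ifPn => // _; rewrite -EFinM lee_fin !mulr_ge0.
- apply/(measurable_restrictT _ _).1 => //; apply: measurable_funTS.
  under eq_fun do rewrite -EFinM.
  by apply/measurable_EFinP; exact: measurable_funM.
have fF := ae_filter_ringOfSetsType mu.
apply: filterS2 uF vG => x -> -> _; rewrite patchE; case: ifPn => xD.
  by rewrite -EFinM lee_fin normrM mulrAC ler_pM// HL.
rewrite fX ?mulr0 ?normr0// ltNge; apply: contra xD.
by rewrite ler_norml inE /= in_itv.
Qed.

Lemma tested_powers_cvg (mN : nat -> posball R) m F (uN : nat -> R -> R)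
    (u f : R -> R) (M C X : R) (l : nat) :
  mu.-integrable [set: TR] (EFin \o F) -> (forall x, `|F x| <= M) ->
  weak_star_cvg mN m ->
  (forall n, {ae mu, forall x, uN n x = convolution F (mN n) x}) ->
  {ae mu, forall x, u x = convolution F m x} ->
  (forall x, `|f x| <= C) -> (forall x, X < `|x| -> f x = 0) ->
  \int[mu]_x ((uN n x ^+ l - u x ^+ l) * f x) @[n --> \oo] --> (0 : R).
Proof.
move=> iF FM mNm uNF uF fC fX.
have M0 : 0 <= M by apply: le_trans (FM 0); exact: normr_ge0.
have C0 : 0 <= C by apply: le_trans (fC 0); exact: normr_ge0.
have mF : measurable_fun [set: TR] F by apply/measurable_EFinP; exact: measurable_int iF.
have [L L0 HL] := exprn_lipschitz l M0.
have cM m' x : `|convolution F m' x| <= M by exact: normr_convolution_le.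
have mc m' : measurable_fun [set: TR] (convolution F m') by exact: measurable_convolution.
(* Adding 1 keeps the divisor positive when [L * C] is 0. *)
have LC0 : 0 < L * C + 1 by rewrite ltr_wpDl// mulr_ge0.
apply/cvgrPdist_le => e e0; have e1 : 0 < e / (L * C + 1) by rewrite divr_gt0.
near=> n; rewrite sub0r normrN -lee_fin.
apply: le_trans (integral_ae_tested_powers_le (mc _) (cM _) (mc _) (cM _)
  (uNF n) uF L0 HL fC fX) _.
apply: (@le_trans _ _ ((L * C)%:E * (e / (L * C + 1))%:E)%E).
  apply: lee_wpmul2l; first by rewrite lee_fin mulr_ge0.
  by near: n; exact: (convolution_L1_cvg X iF FM mNm).
rewrite -EFinM lee_fin mulrCA; apply: ler_piMr; first exact: ltW.
by rewrite ler_pdivrMr// mul1r lerDl.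
Unshelve. all: by end_near. Qed.

(** [K] depends on neither the measures nor the slice of the test function, so it can dominate the
    inner integrals for all [N] and [t]. *)
Lemma tested_powers_bounded F (M C X : R) (l : nat) :
  measurable_fun [set: TR] F -> (forall x, `|F x| <= M) -> exists K : R,
  forall m m' (u v f : R -> R),
    {ae mu, forall x, u x = convolution F m x} ->
    {ae mu, forall x, v x = convolution F m' x} ->
    (forall x, `|f x| <= C) -> (forall x, X < `|x| -> f x = 0) ->
    `|\int[mu]_x ((u x ^+ l - v x ^+ l) * f x)| <= K.
Proof.
move=> mF FM.
have M0 : 0 <= M by apply: le_trans (FM 0); exact: normr_ge0.
have [L L0 HL] := exprn_lipschitz l M0.
have cM m' x : `|convolution F m' x| <= M by exact: normr_convolution_le.
have mc m' : measurable_fun [set: TR] (convolution F m') by exact: measurable_convolution.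
pose D : set TR := `[- X, X]%classic.
have mD : measurable D by exact: measurable_itv.
have Dfin : mu D \is a fin_num.
  rewrite ge0_fin_numE// [X in (X < _)%E]lebesgue_measure_itv/=.
  by case: ifPn => _; rewrite -?EFinB ltry.
exists (L * C * ((M + M) * fine (mu D))) => m m' u v f uF vF fC fX.
have C0 : 0 <= C by apply: le_trans (fC 0); exact: normr_ge0.
rewrite -lee_fin; apply: le_trans (integral_ae_tested_powers_le (mc _) (cM _) (mc _) (cM _)
  uF vF L0 HL fC fX) _.
rewrite [leRHS]EFinM; apply: lee_wpmul2l; first by rewrite lee_fin mulr_ge0.
rewrite EFinM fineK// -integral_cst//.
apply: ge0_le_integral_lower => x _; rewrite lee_fin//.
by rewrite (le_trans (ler_normB _ _))// lerD.
Qed.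

Lemma time_integral_cvg0 (I : nat -> R -> R) (K T : R) :
  (forall n t, 0 <= t -> `|I n t| <= K) ->
  (forall n t, 0 <= t -> T < t -> I n t = 0) ->
  (forall t, 0 <= t -> I n t @[n --> \oo] --> (0 : R)) ->
  \int[mu]_(t in @Rplus R) I n t @[n --> \oo] --> (0 : R).
Proof.
move=> IK IT I0.
have K0 : 0 <= K by apply: le_trans (IK 0%N 0 (lexx _)); exact: normr_ge0.
pose D : set TR := @Rplus R.
have DE : D = `[0, +oo[%classic by apply/seteqP; split => t; rewrite /D /Rplus /= in_itv/= andbT.
have mD : measurable D by rewrite DE; exact: measurable_itv.
(* The dominating function in time, integrable since it is supported in [[0, T]] on the
   half-line. *)
pose g (t : R) : R := if t <= T then K else 0.
have gE t : D t -> g t = (cst K \_ `[0, T]) t.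
  by move=> t0; rewrite patchE /g; congr (if _ then _ else _); rewrite mem_setE in_itv/= t0.
have ig : mu.-integrable D (EFin \o g).
  have mT : measurable (`[0, T]%classic : set TR) by exact: measurable_itv.
  have iK : mu.-integrable [set: TR] (EFin \o (cst K \_ `[0, T])).
    rewrite -restrict_EFin; apply/(integrable_mkcond _ mT).1.
    apply: measurable_bounded_integrable => //.
      by rewrite [X in (X < _)%E]lebesgue_measure_itv/=; case: ifPn => _; rewrite -?EFinB ltry.
    exists K; split; rewrite ?num_real// => z Kz x _ /=.
    by rewrite ger0_norm// ltW.
  apply: (@eq_integrable _ TR R mu D mD (EFin \o (cst K \_ `[0, T]))).
    by move=> t /set_mem tD; rewrite /= gE.
  exact: integrableS iK.
have := @dominated_cvg0_lower _ TR R mu D (fun n t => `|I n t|) g mD.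
move=> /(_ _ _ ig) H.
apply/cvgrPdist_le => e e0.
near=> n; rewrite sub0r normrN -lee_fin.
apply: le_trans (le_normr_Rintegral_lower _ _ _) _.
near: n; apply: cvge0_near => //; apply: H => //.
- move=> n t t0; rewrite /g; case: (leP t T) => [_|Tt]; first exact: (IK n t t0).
  by rewrite (IT n t t0 Tt) normr0.
- by move=> t t0; rewrite -(normr0 R); apply: cvg_norm; exact: (I0 t t0).
Unshelve. all: by end_near. Qed.

End TestedPowers.

(** * Test functions *)

Section TestFunctions.
Context (R : realType).
Variable psi : R * R -> R.
Hypothesis psi_test : Cc_infty_Omega psi.

Let S := closure (@Omega R `&` [set p | psi p != 0]).

Let cpsi : {within @Omega R, continuous psi}.
Proof. by case: psi_test => /(_ 0%N) [] . Qed.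

Lemma closed_Omega : closed (@Omega R).
Proof.
have -> : @Omega R = fst @^-1` [set t : R | 0 <= t] by [].
apply: preimage_closed; last exact: closed_ge.
by move=> p _; exact: cvg_fst.
Qed.

Let cS : compact S. Proof. by case: psi_test. Qed.

Let S_Omega : S `<=` @Omega R.
Proof.
move=> p Sp; rewrite ((closure_id _).1 closed_Omega).
by apply: closure_subset Sp; exact: subIsetl.
Qed.

Let psi_S t x : 0 <= t -> ~ S (t, x) -> psi (t, x) = 0.
Proof.
move=> t0 nS; apply/eqP; apply: contra_notT nS => psi0.
by apply: subset_closure; split.
Qed.

Lemma test_support : exists T : R, forall t x, 0 <= t ->
  T < t \/ T < `|x| -> psi (t, x) = 0.
Proof.
have [M [_ HM]] := compact_bounded cS.
(* Boundedness provides only bounds strictly above [M], hence [M + 1]. The norm on the plane is the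
   maximum norm, so one constant serves for time and space. *)
exists (M + 1) => t x t0 h; apply: psi_S => // Stx.
have := HM (M + 1); rewrite ltrDl ltr01 => /(_ isT (t, x) Stx).
rewrite /= prod_normE /= ge_max => /andP[tM xM].
case: h => [|]; last by rewrite ltNge xM.
by rewrite ltNge (le_trans (ler_norm t) tM).
Qed.

Lemma test_bounded : exists C : R, forall t x, 0 <= t -> `|psi (t, x)| <= C.
Proof.
have [M [_ HM]] : bounded_set (psi @` S).
  apply: compact_bounded; apply: continuous_compact => //.
  exact: continuous_subspaceW S_Omega cpsi.
(* The value 0 serves the points outside the support, [M + 1] those in it. *)
exists (Num.max 0 (M + 1)) => t x t0; rewrite le_max.
have [Stx|nStx] := pselect (S (t, x)).
  apply/orP; right; apply: (HM (M + 1)); first by rewrite ltrDl.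
  by exists (t, x).
by rewrite psi_S// normr0 lexx.
Qed.

Lemma test_continuous t : 0 <= t -> continuous (fun x => psi (t, x)).
Proof.
move=> t0 x.
have /subspace_continuousP/(_ (t, x) t0) cx := cpsi.
move=> B /cx[[U V] /= [Ut Vx] UVB]; apply: filterS Vx => y Vy.
by apply: (UVB (t, y)) => //; split => //=; exact: nbhs_singleton Ut.
Qed.

End TestFunctions.

Unset Implicit Arguments.

Theorem corollary5p4 (R : realType) (n : nat) (G : R -> R)
  (G_even : forall x : R, G (- x) = G x)
  (G_reg : kernel_regular n G)
  (mN : nat -> R -> posball R) (m : R -> posball R)
  (mN_X : forall N : nat, curveX (mN N))
  (m_X : curveX m)
  (mN_m : forall t : R, 0 <= t -> weak_star_cvg (fun N => mN N t) (m t))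
  (psi : R * R -> R) (psi_test : Cc_infty_Omega psi)
  (k l : nat) (k_le_n : (k <= n)%N) :
  let u := fun t : R => convolution G (m t) in
  let uN := fun (N : nat) (t : R) => convolution G (mN N t) in
  (\int[mN N 0]_x psi (0, x) @[N --> \oo] --> \int[m 0]_x psi (0, x)) /\
  ((\int[@lebesgue_measure R]_(t in @Rplus R)
      (\int[@lebesgue_measure R]_x
         (((derive1n k (uN N t) x) ^+ l - (derive1n k (u t) x) ^+ l) * psi (t, x))))
     @[N --> \oo] --> (0 : R)).

Proof.
move=> u uN.
have [T psi0] := test_support psi_test.
have [C psiC] := test_bounded psi_test.
have cpsi := test_continuous psi_test.
(* The slice of [psi] at time 0 is continuous with compact support, so the first limit is an
   instance of weak* convergence. *)
split.
  apply: mN_m => //; apply: (@C0_compact_support _ _ T); first exact: cpsi.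
  by move=> x Tx; apply: psi0 => //; right.
have [F [M [iF FM derE]]] := derive1n_convolution_ae G_reg k_le_n.
have mF : measurable_fun [set: measurableTypeR R] F.
  by apply/measurable_EFinP; exact: measurable_int iF.
have [K HK] := tested_powers_bounded C T l mF FM.
apply: (@time_integral_cvg0 _ _ K T).
- move=> N t t0; apply: HK (derE _) (derE _) _ _ => [x|x Tx]; first exact: psiC.
  by apply: psi0 => //; right.
(* Beyond time [T] the whole slice of [psi] vanishes, and so does the inner integral. *)
- move=> N t t0 Tt; rewrite (_ : (fun _ => _) = cst 0) ?Rintegral_cst ?mul0r//.
  by apply/funext => x; rewrite psi0 ?mulr0//; left.
- move=> t t0; apply: (tested_powers_cvg (C := C) (X := T) l iF FM (mN_m t t0)).
  + by move=> N; exact: derE.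
  + exact: derE.
  + by move=> x; exact: psiC.
  + by move=> x Tx; apply: psi0 => //; right.
Qed.
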